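(* The problem \textsc{NS-Foremost-path TGR} can be solved in $\mathcal{O}(n^3\log n)$ time and $\mathcal{O}(n^2)$ space. Furthermore, if the instance is realizable, a realization with at most $n^2$ time labels in total can be computed within the same time and space bounds.
   Context: A temporal graph $\mathcal{G}=(G,\lambda)$ consists of a static undirected graph $G=(V,E)$ with $V=[n]$ and a labeling $\lambda:E\to 2^{\mathbb{N}_{>0}}$ assigning to each edge the (finite) set of positive times at which it appears; the number of time labels is $\sum_{e}|\lambda(e)|$. A non-strict temporal $uv$-path is a path $u=v_0,\dots,v_k=v$ in $G$ with pairwise distinct vertices together with times $\tau_1\le\tau_2\le\dots\le\tau_k$ with $\tau_i\in\lambda(\{v_{i-1},v_i\})$; its arrival time is $\tau_k$. $\mathrm{NS}\text{-}\mathrm{Fo}(\mathcal{G})$ is the $n\times n$ matrix with diagonal $0$ and entry $(u,v)$, $u\neq v$, equal to the minimum arrival time of a non-strict temporal $uv$-path ($\infty$ if none). A distance matrix is an $n\times n$ matrix with entries in $\mathbb{N}\cup\{\infty\}$, zero exactly on the diagonal. \textsc{NS-Foremost-path TGR}: given $n$ and an $n\times n$ distance matrix $D$, decide whether there is a temporal graph $\mathcal{G}$ on $[n]$ with $\mathrm{NS}\text{-}\mathrm{Fo}(\mathcal{G})=D$ (a realization). *)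

(* Defs.v *)
From mathcomp Require Import all_boot all_order all_algebra.
From mathcomp Require Import finmap boolp.

Set Implicit Arguments.
Unset Strict Implicit.
Unset Printing Implicit Defensive.

(** * Temporal graphs and non-strict foremost paths *)

(* The values of [labels] outside [edges] are irrelevant: no definition below
   looks at them. *)
Record tgraph (n : nat) := TGraph {
  edges : {set {set 'I_n}};
  labels : {set 'I_n} -> {fset nat};
  edges_card2 : forall e, e \in edges -> #|e| = 2;
  labels_gt0 : forall e t, e \in edges -> t \in labels e -> 0 < t
}.

Definition num_labels n (G : tgraph n) : nat :=
  \sum_(e in edges G) #|` labels G e|.

(* A temporal path u = v_0, v_1, ..., v_k with times tau_1, ..., tau_k is given
   by u and the sequence of steps (v_1, tau_1), ..., (v_k, tau_k). *)
Fixpoint steps_in n (G : tgraph n) (u : 'I_n) (s : seq ('I_n * nat)) : bool :=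
  if s is (v, t) :: s' then
    [&& [set u; v] \in edges G, t \in labels G [set u; v] & steps_in G v s']
  else true.

Definition ns_path n (G : tgraph n) (u v : 'I_n) (s : seq ('I_n * nat)) : bool :=
  [&& uniq (u :: unzip1 s), last u (unzip1 s) == v,
      sorted leq (unzip2 s) & steps_in G u s].

Definition arrival n (s : seq ('I_n * nat)) : nat := last 0 (unzip2 s).

Definition arrives_at n (G : tgraph n) (u v : 'I_n) : pred nat :=
  fun t => `[< exists2 s, ns_path G u v s & arrival s = t >].

(* [None] stands for infinity. *)
Definition NS_Fo n (G : tgraph n) : 'M[option nat]_n :=
  \matrix_(u, v)
    if u == v then Some 0
    else if pselect (exists t, arrives_at G u v t) is left ex_t
         then Some (ex_minn ex_t) else None.

Definition distance_matrix n (D : 'M[option nat]_n) : Prop :=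
  forall u v, D u v = Some 0 <-> u = v.

Definition realizable n (D : 'M[option nat]_n) : Prop :=
  exists G : tgraph n, NS_Fo G = D.

(** * Word RAM *)

(* Programs are those of a unit-cost random access machine with structured
   control flow: natural-number registers (of which a given program mentions
   only finitely many) and a memory of natural-number cells with indirect
   addressing. [Minus] is truncated; [Less] and [Equal] return 0 or 1. *)
Inductive expr :=
| Const of nat
| Reg of nat
| Read of expr
| Plus of expr & expr
| Minus of expr & expr
| Times of expr & expr
| Less of expr & expr
| Equal of expr & expr.

Inductive prog :=
| Skip
| Assign of nat & expr
| Write of expr & expr
| Seq of prog & prog
| If of expr & prog & prog
| While of expr & prog.

Record state := State { regs : nat -> nat; cells : nat -> nat }.

Definition upd (f : nat -> nat) (a v : nat) : nat -> nat :=
  fun b => if b == a then v else f b.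

Fixpoint eval (st : state) (e : expr) : nat :=
  match e with
  | Const k => k
  | Reg r => regs st r
  | Read e1 => cells st (eval st e1)
  | Plus e1 e2 => eval st e1 + eval st e2
  | Minus e1 e2 => eval st e1 - eval st e2
  | Times e1 e2 => eval st e1 * eval st e2
  | Less e1 e2 => eval st e1 < eval st e2
  | Equal e1 e2 => eval st e1 == eval st e2
  end.

Fixpoint cost (e : expr) : nat :=
  match e with
  | Const _ | Reg _ => 1
  | Read e1 => (cost e1).+1
  | Plus e1 e2 | Minus e1 e2 | Times e1 e2 | Less e1 e2 | Equal e1 e2 =>
      (cost e1 + cost e2).+1
  end.

(* [fits m w st e]: evaluating [e] only reads cells of address less than [m]
   and only produces values less than [w], intermediate ones included. *)
Fixpoint fits (m w : nat) (st : state) (e : expr) : bool :=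
  (eval st e < w) &&
  match e with
  | Const _ | Reg _ => true
  | Read e1 => fits m w st e1 && (eval st e1 < m)
  | Plus e1 e2 | Minus e1 e2 | Times e1 e2 | Less e1 e2 | Equal e1 e2 =>
      fits m w st e1 && fits m w st e2
  end.

(* [exec m w p st st' t]: from [st], the program [p] halts in [st'] after [t]
   elementary operations, accessing only the memory cells 0, ..., m - 1 and
   with all values less than [w]; exceeding either limit gets it stuck. *)
Inductive exec (m w : nat) : prog -> state -> state -> nat -> Prop :=
| ExecSkip st : exec m w Skip st st 1
| ExecAssign r e st :
    fits m w st e ->
    exec m w (Assign r e) st (State (upd (regs st) r (eval st e)) (cells st))
      (cost e).+1
| ExecWrite a e st :
    fits m w st a -> eval st a < m -> fits m w st e ->
    exec m w (Write a e) st
      (State (regs st) (upd (cells st) (eval st a) (eval st e)))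
      (cost a + cost e).+1
| ExecSeq p q st1 st2 st3 t1 t2 :
    exec m w p st1 st2 t1 -> exec m w q st2 st3 t2 ->
    exec m w (Seq p q) st1 st3 (t1 + t2)
| ExecIf e p q st st' t :
    fits m w st e ->
    exec m w (if eval st e != 0 then p else q) st st' t ->
    exec m w (If e p q) st st' (cost e + t).+1
| ExecWhileStop e p st :
    fits m w st e -> eval st e = 0 ->
    exec m w (While e p) st st (cost e).+1
| ExecWhileLoop e p st1 st2 st3 t1 t2 :
    fits m w st1 e -> eval st1 e != 0 ->
    exec m w p st1 st2 t1 -> exec m w (While e p) st2 st3 t2 ->
    exec m w (While e p) st1 st3 (cost e + t1 + t2).+1.

(** * Solving NS-Foremost-path TGR on the word RAM *)

Definition encode (d : option nat) : nat := if d is Some k then k.+1 else 0.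

(* Register 0 holds n, and cells 0, ..., n ^ 2 - 1 hold D in row-major order;
   everything else is 0. *)
Definition input n (D : 'M[option nat]_n) : state :=
  State (upd (fun=> 0) 0 n)
    (nth 0 [seq encode (D u v) | u <- enum 'I_n, v <- enum 'I_n]).

(* Words of O(log (n + M)) bits, M being the largest finite entry of D. *)
Definition word_bound (c n : nat) (D : 'M[option nat]_n) : nat :=
  (n + (\max_(u < n) \max_(v < n) odflt 0 (D u v)) + 2) ^ c.

Definition halts_within (time space : nat -> nat) (c : nat) (p : prog)
    n (D : 'M[option nat]_n) (Q : state -> Prop) : Prop :=
  exists st t,
    [/\ exec (space n) (word_bound c D) p (input D) st t, t <= time n & Q st].

(* The answer is returned in register 0: 1 for yes, 0 for no. *)
Definition decides_NS_Fo_TGR (time space : nat -> nat) (p : prog) : Prop :=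
  exists c, forall n (D : 'M[option nat]_n), distance_matrix D ->
    halts_within time space c p D (fun st => regs st 0 = `[< realizable D >]).

(* A temporal graph is returned as an array of triples (u, v, t), whose length
   is in register 0 and whose first address is in register 1. *)
Definition output (st : state) : seq (nat * nat * nat) :=
  let b := regs st 1 in
  [seq (cells st (b + 3 * i), cells st (b + 3 * i + 1), cells st (b + 3 * i + 2))
     | i <- iota 0 (regs st 0)].

(* [s] lists, without repetition, the time labels t of the edges {u, v},
   u < v, of [G]; as all edges have a label, it determines [G]. *)
Definition lists_tgraph n (s : seq (nat * nat * nat)) (G : tgraph n) : Prop :=
  [/\ uniq s,
      forall a b t, (a, b, t) \in s <->
        exists u v : 'I_n, [/\ a = u, b = v, u < v,
          [set u; v] \in edges G & t \in labels G [set u; v]] &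
      forall e, e \in edges G -> labels G e != fset0].

Definition computes_NS_Fo_realization (time space : nat -> nat) (p : prog) : Prop :=
  exists c, forall n (D : 'M[option nat]_n), distance_matrix D ->
    realizable D ->
    halts_within time space c p D (fun st =>
      exists G : tgraph n,
        [/\ lists_tgraph (output st) G, NS_Fo G = D & num_labels G <= n ^ 2]).

Definition bigO (f g : nat -> nat) : Prop :=
  exists C N, forall n, N <= n -> f n <= C * g n.

(* Main.v *)
Require Import Defs.
From mathcomp Require Import all_boot matrix finmap boolp zify.

(** Reaching a vertex by time [t] is decided by the connected components of the
    snapshots, so an edge {v, w} may carry the label [t] iff every vertex
    reaches both or none of [v] and [w] by time [t]. Hence [D] is realizable iff
    each finite entry [D u v = t], [u != v], has a predecessor [w] with
    [D u w < t] such that columns [v] and [w] of [D] agree when thresholded at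
    [t], and then the labels [t] on {w, v}, one for each (u, v), are a
    realization.

    All predecessors are found in time O(n^3): for fixed columns [a] and [b] and
    [t = D u b], the columns agree at threshold [t] iff the maximum of [D x a]
    over [D x b <= t] is at most [t] and the minimum of [D x a] over
    [D x b > t] exceeds [t]. Once the entries of column [b] are replaced by
    their ranks, these extrema are prefix maxima of an array of length n + 1,
    computed in time O(n) for each pair (a, b). *)

Set Implicit Arguments.
Unset Strict Implicit.
Unset Printing Implicit Defensive.

(** * Foremost paths and predecessors *)

(** The predecessor criterion asks for a strictly earlier [w] because this permits induction on time
    when foremost paths are rebuilt. What shapes the rest is that time, space and word length are
    claimed for an actual machine program. The program is therefore written with loops that always
    run exactly [n] times and without branching: every decision is a 0/1 factor in an arithmetic
    expression. Its running time then depends only on the nesting depth of the loops, which has to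
    stay at three. This rules out comparing two columns afresh for every source, makes counting good
    enough for the ranks, and leaves only linear time per pair for removing duplicates. Duplicates
    do arise, since different sources may call for the same label on the same edge, while the output
    must list each label once. Word length is controlled by cost alone: an expression of cost [c]
    over values at most [V] stays below or at [V ^ c], and all costs are constants. *)

Definition le_time (d : option nat) (t : nat) : bool :=
  if d is Some k then k <= t else false.

Section Paths.
Variables (n : nat) (G : tgraph n).
Implicit Types (u v w x : 'I_n) (s : seq ('I_n * nat)) (t : nat).

Definition has_label v w t := ([set v; w] \in edges G) && (t \in labels G [set v; w]).

Lemma has_labelC v w t : has_label v w t = has_label w v t.
Proof. by rewrite /has_label setUC. Qed.

Lemma steps_in_rcons u s v t :
  steps_in G u (rcons s (v, t)) =
  steps_in G u s && has_label (last u (unzip1 s)) v t.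
Proof.
elim: s u => [|[w k] s IH] u /=; first by rewrite andbT.
by rewrite IH !andbA.
Qed.

Lemma sorted_leq_rcons (l : seq nat) t :
  sorted leq (rcons l t) = sorted leq l && (last 0 l <= t).
Proof. by case: l => [|a l] //=; rewrite rcons_path. Qed.

Lemma ns_path_nil u v : ns_path G u v [::] = (u == v).
Proof. by rewrite /ns_path /= !andbT. Qed.

Lemma ns_path_rcons u v s w t :
  ns_path G u v (rcons s (w, t)) =
  [&& ns_path G u (last u (unzip1 s)) s, w \notin u :: unzip1 s, w == v,
      arrival s <= t & has_label (last u (unzip1 s)) w t].
Proof.
rewrite /ns_path /arrival /unzip1 /unzip2 !map_rcons -rcons_cons -/(unzip1 s) -/(unzip2 s).
rewrite last_rcons sorted_leq_rcons steps_in_rcons rcons_uniq eqxx.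
case: (w \notin _) => /=; last by rewrite !andbF.
case: (w == v) => /=; last by rewrite !andbF.
case: (sorted _ _) => /=; last by rewrite !andbF.
case: (_ <= _) => /=; last by rewrite !andbF.
by rewrite andbA.
Qed.

Lemma arrival_rcons s v t : arrival (rcons s (v, t)) = t.
Proof. by rewrite /arrival /unzip2 map_rcons last_rcons. Qed.

(** Paths are simple, so a step to a vertex already visited cannot be appended; the prefix ending
    there takes its place. *)
Lemma ns_path_prefix u v s z :
  ns_path G u v s -> z \in u :: unzip1 s ->
  exists2 s', ns_path G u z s' & arrival s' <= arrival s.
Proof.
elim/last_ind: s v => [|s [w t] IH] v.
  rewrite ns_path_nil inE => _ /eqP ->; exists [::] => //.
  by rewrite ns_path_nil.
move=> ns_s; have := ns_s; rewrite ns_path_rcons => /and5P[ps _ /eqP wv le_t _].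
rewrite /unzip1 map_rcons -rcons_cons mem_rcons inE => /orP[/eqP ->|/(IH _ ps)].
  by exists (rcons s (w, t)) => //=; move: ns_s; rewrite wv.
by case=> s' ps' le_s'; exists s' => //; rewrite arrival_rcons (leq_trans le_s').
Qed.

(** The diagonal is no exception: the empty path arrives at time 0. *)
Lemma le_NS_FoP u v t :
  reflect (exists2 s, ns_path G u v s & arrival s <= t)
          (le_time (NS_Fo G u v) t).
Proof.
rewrite /NS_Fo mxE; case: eqP => [<-|neq].
  by apply: ReflectT; exists [::]; rewrite ?ns_path_nil.
case: pselect => [ex|nex] /=; last first.
  apply: ReflectF => -[s ps _]; apply: nex.
  by exists (arrival s); apply/asboolP; exists s.
apply: (iffP idP); case: ex_minnP => k /asboolP[s ps <-] min_s.
  by move=> le_t; exists s.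
case=> s' ps' le_t.
by apply: leq_trans le_t; apply: min_s; apply/asboolP; exists s'.
Qed.

Lemma NS_Fo_label x y z t :
  has_label y z t -> le_time (NS_Fo G x y) t -> le_time (NS_Fo G x z) t.
Proof.
move=> lab /le_NS_FoP[s ps le_t]; apply/le_NS_FoP.
case: (boolP (z \in x :: unzip1 s)) => [z_in|z_notin].
  by have [s' ps' le_s'] := ns_path_prefix ps z_in; exists s' => //; lia.
exists (rcons s (z, t)); last by rewrite arrival_rcons.
have last_s : last x (unzip1 s) = y by case/and4P: ps => _ /eqP.
by rewrite ns_path_rcons last_s ps z_notin eqxx le_t lab.
Qed.

Lemma NS_Fo_label_eq x y z t :
  has_label y z t -> le_time (NS_Fo G x y) t = le_time (NS_Fo G x z) t.
Proof.
move=> lab; apply/idP/idP; apply: NS_Fo_label => //; by rewrite has_labelC.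
Qed.

End Paths.

(* [w] can be the predecessor of [v] on a foremost path from [u]: an edge
   {w, v} may carry the label [t] exactly when every vertex reaches both or
   none of [w] and [v] by time [t]. *)
Definition witness n (D : 'M[option nat]_n) (u v w : 'I_n) : Prop :=
  exists2 t, D u v = Some t &
    (exists2 k, D u w = Some k & k < t) /\
    forall x, le_time (D x w) t = le_time (D x v) t.

(** Walk back from [v] along the final steps labelled [t]. Each such edge preserves which vertices
    are reached from where by time [t], and the walk stops at the first vertex whose prefix arrives
    before [t]. *)
Lemma NS_Fo_witness n (G : tgraph n) u v t :
  u != v -> NS_Fo G u v = Some t -> exists w, witness (NS_Fo G) u v w.
Proof.
move=> uv Dt.
have /le_NS_FoP[s ps le_s] : le_time (NS_Fo G u v) t by rewrite Dt /=.
have ge_s : t <= arrival s.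
  have : le_time (NS_Fo G u v) (arrival s) by apply/le_NS_FoP; exists s.
  by rewrite Dt.
have arr_s : arrival s = t by lia.
suff [w lt_w eq_w] : exists2 w, exists2 k, NS_Fo G u w = Some k & k < t &
    forall x, le_time (NS_Fo G x w) t = le_time (NS_Fo G x v) t.
  by exists w, t.
move: uv ps arr_s; clear Dt le_s ge_s.
elim/last_ind: s v => [|s [z k] IH] v uv.
  by rewrite ns_path_nil (negPf uv).
rewrite ns_path_rcons arrival_rcons => /and5P[ps _ /eqP -> le_t lab] kt.
move: le_t lab; rewrite kt; set y := last _ _ in ps * => le_t lab.
(* Labels are positive, so the empty prefix, of arrival 0, is strictly earlier and the walk stops at
   [u] at the latest. *)
have t_gt0 : 0 < t by case/andP: lab; apply: labels_gt0.
have eq_yv x : le_time (NS_Fo G x y) t = le_time (NS_Fo G x v) t.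
  exact: NS_Fo_label_eq.
have [lt_t|eq_t] : arrival s < t \/ arrival s = t by lia.
  exists y => //.
  have : le_time (NS_Fo G u y) (arrival s) by apply/le_NS_FoP; exists s.
  by case: (NS_Fo G u y) => //= k' le_k'; exists k' => //; lia.
have [yu|neq_yu] := eqVneq u y.
  by exists y => //; exists 0 => //; rewrite -yu /NS_Fo mxE eqxx.
have [w lt_w eq_w] := IH _ neq_yu ps eq_t.
by exists w => // x; rewrite eq_w.
Qed.

(** * Sufficiency: sound labels with strictly earlier predecessors *)

Section Realization.
Variables (n : nat) (D : 'M[option nat]_n) (G : tgraph n).
Hypothesis Ddist : distance_matrix D.
Hypothesis label_ok : forall v w t x,
  has_label G v w t -> le_time (D x v) t = le_time (D x w) t.
Hypothesis label_ex : forall u v t, u != v -> D u v = Some t ->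
  exists w, (exists2 k, D u w = Some k & k < t) /\ has_label G w v t.

(** Lower bound on arrivals: by [label_ok], an edge used at time [t] never leads from a vertex that
    [D] allows by [t] to one that it does not. *)
Lemma ns_path_ge u v s : ns_path G u v s -> le_time (D u v) (arrival s).
Proof.
elim/last_ind: s v => [|s [z k] IH] v.
  by rewrite ns_path_nil => /eqP <-; have [_ ->] := Ddist u u.
rewrite ns_path_rcons arrival_rcons => /and5P[/IH le_y _ /eqP <- le_t lab].
rewrite -(label_ok _ lab).
by move: le_y; case: (D u _) => //= j; lia.
Qed.

(** Strong induction on the time, extending a foremost path to the predecessor by one edge. *)
Lemma ns_path_foremost u v t :
  D u v = Some t -> exists2 s, ns_path G u v s & arrival s = t.
Proof.
have [m] := ubnP t; elim: m t v => // m IH t v lt_m Dt.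
have [uv|uv] := eqVneq u v.
  exists [::]; rewrite ?ns_path_nil ?uv //.
  by move: Dt; have [_ ->] := Ddist u v => //; case.
have [w [[k Dk lt_k] lab]] := label_ex uv Dt.
have [|s ps arr_s] := IH _ _ _ Dk; first lia.
exists (rcons s (v, t)); last by rewrite arrival_rcons.
have last_s : last u (unzip1 s) = w by case/and4P: ps => _ /eqP.
rewrite ns_path_rcons last_s ps eqxx lab arr_s (ltnW lt_k) /= andbT.
(* If [v] were already visited, a prefix would reach it by time [k < t], against [ns_path_ge]; so
   the extended path is simple. *)
apply/negP => v_in; have [s' ps' le_s'] := ns_path_prefix ps v_in.
by have := ns_path_ge ps'; rewrite Dt /=; lia.
Qed.

Lemma NS_Fo_eq : NS_Fo G = D.
Proof.
apply/matrixP => u v.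
have le_eq t : le_time (NS_Fo G u v) t = le_time (D u v) t.
  apply/le_NS_FoP/idP => [[s /ns_path_ge]|].
    by case: (D u v) => //= k; lia.
  case Dk: (D u v) => [k|//] /= le_k.
  by have [s ps arr_s] := ns_path_foremost Dk; exists s; rewrite ?arr_s.
move: le_eq; case: (NS_Fo G u v) (D u v) => [k|] [j|] //= le_eq.
- by congr Some; have := le_eq k; have := le_eq j; lia.
- by have := le_eq k; rewrite leqnn.
- by have := le_eq j; rewrite leqnn.
Qed.

End Realization.

(** * Temporal graphs from lists of triples *)

Lemma tgraph_of_list n (L : seq (nat * nat * nat)) :
  uniq L ->
  (forall a b t, (a, b, t) \in L -> [/\ a < b, b < n & 0 < t]) ->
  exists G : tgraph n,
    [/\ lists_tgraph L G, num_labels G <= size L &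
        forall (v w : 'I_n) t, has_label G v w t =
          ((val v, val w, t) \in L) || ((val w, val v, t) \in L)].
Proof.
move=> uL okL.
pose edge_of (k : nat * nat * nat) (e : {set 'I_n}) :=
  [exists v : 'I_n, exists w : 'I_n,
    [&& val v == k.1.1, val w == k.1.2 & e == [set v; w]]].
pose E := [set e | has (edge_of^~ e) L].
pose lab e := [fset t in [seq k.2 | k <- L & edge_of k e]]%fset.
have edgeP k e : k \in L -> reflect (exists v w : 'I_n,
    [/\ v < w, val v = k.1.1, val w = k.1.2 & e = [set v; w]]) (edge_of k e).
  case: k => -[a b] t kL; apply: (iffP existsP) => -[v].
    case/existsP => w /and3P[/eqP /= va /eqP wb /eqP ->].
    by exists v, w; split=> //; have [] := okL _ _ _ kL; lia.
  case=> w [_ /= va wb ->]; exists v; apply/existsP; exists w.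
  by rewrite /= va wb !eqxx.
have labP e t : t \in lab e -> exists2 k, k \in L & edge_of k e /\ k.2 = t.
  rewrite !inE /= => /mapP[k]; rewrite mem_filter => /andP[ke kL] ->.
  by exists k.
have E2 e : e \in E -> #|e| = 2.
  rewrite inE => /hasP[k kL /(edgeP _ _ kL)[v [w [vw _ _ ->]]]].
  by rewrite cards2; case: eqP vw => // ->; rewrite ltnn.
have lab_gt0 e t : e \in E -> t \in lab e -> 0 < t.
  by move=> _ /labP[[[a b] t'] kL [_ <-]]; have [] := okL _ _ _ kL.
pose G := TGraph E2 lab_gt0.
have labG v w t : has_label G v w t =
    ((val v, val w, t) \in L) || ((val w, val v, t) \in L).
  apply/andP/orP => /= [[_ /labP[[[a b] t'] kL [/(edgeP _ _ kL)]]]|].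
    case=> v' [w' [lt_vw /= va wb eq_e]] tt'.
    have : v' \in [set v; w] by rewrite eq_e !inE eqxx.
    have : w' \in [set v; w] by rewrite eq_e !inE eqxx orbT.
    rewrite !inE => /orP[] /eqP ew /orP[] /eqP ev.
    - by move: lt_vw; rewrite ev ew ltnn.
    - by right; rewrite -ew -ev /= va wb -tt'.
    - by left; rewrite -ew -ev /= va wb -tt'.
    - by move: lt_vw; rewrite ev ew ltnn.
  move=> kL'; have [k kL [ke kt]] : exists2 k, k \in L & edge_of k [set v; w] /\ k.2 = t.
    case: kL' => kL; [exists (val v, val w, t)|exists (val w, val v, t)] => //.
      split=> //; apply/(edgeP _ _ kL); exists v, w; split=> //.
      by have [] := okL _ _ _ kL.
    split=> //; apply/(edgeP _ _ kL); exists w, v; split; rewrite ?(setUC [set v]) //.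
    by have [] := okL _ _ _ kL.
  split; first by rewrite inE; apply/hasP; exists k.
  by rewrite !inE /=; apply/mapP; exists k; rewrite ?mem_filter ?ke.
exists G; split=> //.
  split=> //.
    move=> a b t; split=> [kL|[u [v [-> -> uv eE tl]]]].
      have [ab bn _] := okL _ _ _ kL.
      exists (Ordinal (ltn_trans ab bn)), (Ordinal bn).
      have /andP[eE tl] : has_label G (Ordinal (ltn_trans ab bn)) (Ordinal bn) t.
        by rewrite labG kL.
      by split.
    have : has_label G u v t by apply/andP.
    by rewrite labG => /orP[//|/okL[/(ltn_trans uv)]]; rewrite ltnn.
  move=> e; rewrite inE => /hasP[k kL ke]; apply/fset0Pn; exists k.2.
  by rewrite !inE /=; apply/mapP; exists k; rewrite ?mem_filter ?ke.
rewrite /num_labels /=.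
(* Double counting: each label of an edge comes from some triple, and a triple matches at most one
   edge. *)
have le_lab e : #|` lab e| <= \sum_(k <- L) edge_of k e.
  rewrite /lab card_fseq (leq_trans (size_undup _)) // size_map size_filter.
  by rewrite -sum1_count big_mkcond /=; apply: leq_sum => k _; case: ifP.
apply: leq_trans (leq_sum _ (fun e _ => le_lab e)) _.
rewrite exchange_big /= -sum1_size big_seq [leqRHS]big_seq.
apply: leq_sum => k kL.
case: (boolP [exists e, edge_of k e]) => [/existsP[e ke]|/existsPn nk]; last first.
  by rewrite big1 // => e _; rewrite (negPf (nk e)).
have eq_e e' : edge_of k e' -> e' = e.
  move=> ke'; have [v [w [_ va wb ->]]] := edgeP _ _ kL ke.
  have [v' [w' [_ va' wb' ->]]] := edgeP _ _ kL ke'.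
  by congr [set _; _]; apply: val_inj; rewrite ?va ?va' ?wb ?wb'.
apply: (@leq_trans (\sum_(e' | e' == e) 1)); last by rewrite big_pred1_eq.
rewrite big_mkcond [X in _ <= X]big_mkcond /=.
apply: leq_sum => e' _; case: ifP => // _; case: (boolP (edge_of k e')) => //.
by move=> /eq_e ->; rewrite eqxx.
Qed.

(** * A structured language with bounded loops *)

Inductive aexpr :=
| Cst of nat
| Rg of nat
| Rd of nat & aexpr
| Add of aexpr & aexpr
| Dif of aexpr & aexpr
| Mul of aexpr & aexpr
| Lt of aexpr & aexpr
| Eq of aexpr & aexpr.

Inductive cmd :=
| Asg of nat & aexpr
| Wr of nat & aexpr & aexpr
| Sq of cmd & cmd
| For of nat & cmd.

Record astate := AState { reg : nat -> nat; cell : nat -> nat -> nat }.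

Definition set_reg (st : astate) (r v : nat) : astate :=
  AState (upd (reg st) r v) (cell st).

Definition set_mem (st : astate) (k i v : nat) : astate :=
  AState (reg st)
    (fun k' j => if (k' == k) && (j == i) then v else cell st k' j).

Fixpoint aeval (st : astate) (e : aexpr) : nat :=
  match e with
  | Cst k => k
  | Rg r => reg st r
  | Rd k e1 => cell st k (aeval st e1)
  | Add e1 e2 => aeval st e1 + aeval st e2
  | Dif e1 e2 => aeval st e1 - aeval st e2
  | Mul e1 e2 => aeval st e1 * aeval st e2
  | Lt e1 e2 => aeval st e1 < aeval st e2
  | Eq e1 e2 => aeval st e1 == aeval st e2
  end.

Definition address (k : nat) (e : expr) : expr :=
  Plus (Times (Const k) (Reg 1)) e.

Fixpoint expr_of (e : aexpr) : expr :=
  match e with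
  | Cst k => Const k
  | Rg r => Reg r
  | Rd k e1 => Read (address k (expr_of e1))
  | Add e1 e2 => Plus (expr_of e1) (expr_of e2)
  | Dif e1 e2 => Minus (expr_of e1) (expr_of e2)
  | Mul e1 e2 => Times (expr_of e1) (expr_of e2)
  | Lt e1 e2 => Less (expr_of e1) (expr_of e2)
  | Eq e1 e2 => Equal (expr_of e1) (expr_of e2)
  end.

Fixpoint prog_of (c : cmd) : prog :=
  match c with
  | Asg r e => Assign r (expr_of e)
  | Wr k e1 e2 => Write (address k (expr_of e1)) (expr_of e2)
  | Sq c1 c2 => Seq (prog_of c1) (prog_of c2)
  | For r c1 =>
      Seq (Assign r (Const 0))
        (While (Less (Reg r) (Reg 0))
           (Seq (prog_of c1) (Assign r (Plus (Reg r) (Const 1)))))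
  end.

Fixpoint set_regs (c : cmd) : seq nat :=
  match c with
  | Asg r _ => [:: r]
  | Wr _ _ _ => [::]
  | Sq c1 c2 => set_regs c1 ++ set_regs c2
  | For r c1 => r :: set_regs c1
  end.

Fixpoint set_regions (c : cmd) : seq nat :=
  match c with
  | Asg _ _ => [::]
  | Wr k _ _ => [:: k]
  | Sq c1 c2 => set_regions c1 ++ set_regions c2
  | For _ c1 => set_regions c1
  end.

Fixpoint max_const (e : expr) : nat :=
  match e with
  | Const k => k
  | Reg _ => 0
  | Read e1 => max_const e1
  | Plus e1 e2 | Minus e1 e2 | Times e1 e2 | Less e1 e2 | Equal e1 e2 =>
      maxn (max_const e1) (max_const e2)
  end.

Definition small_expr (kmax cmax : nat) (e : expr) : bool :=
  (max_const e <= kmax) && (cost e <= cmax).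

Fixpoint small_cmd (kmax cmax : nat) (c : cmd) : bool :=
  match c with
  | Asg _ e => small_expr kmax cmax (expr_of e)
  | Wr k e1 e2 => small_expr kmax cmax (address k (expr_of e1)) &&
                  small_expr kmax cmax (expr_of e2)
  | Sq c1 c2 => small_cmd kmax cmax c1 && small_cmd kmax cmax c2
  | For r c1 => [&& r != 0, r != 1, r \notin set_regs c1 & small_cmd kmax cmax c1]
  end.

(** A loop pays 2 for resetting the counter and 4 for the failing test; each round pays 4 for the
    successful test and 4 for the increment. *)
Fixpoint cmd_time (n : nat) (c : cmd) : nat :=
  match c with
  | Asg _ e => (cost (expr_of e)).+1
  | Wr k e1 e2 => (cost (address k (expr_of e1)) + cost (expr_of e2)).+1
  | Sq c1 c2 => cmd_time n c1 + cmd_time n c2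
  | For _ c1 => 6 + n * (cmd_time n c1 + 8)
  end.

Fixpoint for_depth (c : cmd) : nat :=
  match c with
  | Asg _ _ | Wr _ _ _ => 0
  | Sq c1 c2 => maxn (for_depth c1) (for_depth c2)
  | For _ c1 => (for_depth c1).+1
  end.

(** The base [n.+1] keeps the powers positive, so that they absorb additive constants even for
    [n = 0]. *)
Lemma cmd_time_poly (c : cmd) :
  exists K, forall n, cmd_time n c <= K * n.+1 ^ for_depth c.
Proof.
elim: c => [r e|k e1 e2|c1 [K1 IH1] c2 [K2 IH2]|r c [K IH]] /=.
- by eexists => n; rewrite muln1.
- by eexists => n; rewrite muln1.
- exists (K1 + K2) => n; rewrite mulnDl leq_add //.
    by rewrite (leq_trans (IH1 n)) // leq_mul // leq_pexp2l // leq_maxl.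
  by rewrite (leq_trans (IH2 n)) // leq_mul // leq_pexp2l // leq_maxr.
exists (K + 14) => n; rewrite expnS; move: (IH n).
have : 0 < n.+1 ^ for_depth c by rewrite expn_gt0.
move: (cmd_time n c) (n.+1 ^ for_depth c) => t p p_gt0 le_t; nia.
Qed.

Lemma region_inj S k i k' i' :
  i < S -> i' < S -> k * S + i = k' * S + i' -> k = k' /\ i = i'.
Proof.
move=> lt_i lt_i' E; have S_gt0 : 0 < S by lia.
have := congr1 (divn^~ S) E; rewrite !divnMDl // !divn_small // !addn0 => ek.
by split=> //; move: E; rewrite ek; lia.
Qed.

(** * Semantics of the language and its simulation on the word RAM *)

Section Machine.

(* Memory is cut into [regions] blocks of [S] cells; block [k] starts at
   address [k * S]. Values stored in registers and cells are at most [V]. *)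
Variables (regions n S V : nat).

Fixpoint esafe (st : astate) (e : aexpr) : Prop :=
  match e with
  | Cst _ | Rg _ => True
  | Rd k e1 => [/\ esafe st e1, k < regions & aeval st e1 < S]
  | Add e1 e2 | Dif e1 e2 | Mul e1 e2 | Lt e1 e2 | Eq e1 e2 =>
      esafe st e1 /\ esafe st e2
  end.

Fixpoint run (c : cmd) (st : astate) : astate :=
  match c with
  | Asg r e => set_reg st r (aeval st e)
  | Wr k e1 e2 => set_mem st k (aeval st e1) (aeval st e2)
  | Sq c1 c2 => run c2 (run c1 st)
  | For r c1 =>
      iteri n (fun i st' => set_reg (run c1 st') r i.+1) (set_reg st r 0)
  end.

(** [run] is total and ignores the limits of the machine; [safe] records that accesses stay inside
    their block and stored values are at most [V]. Intermediate values are left to [eval_le]. *)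
Fixpoint safe (c : cmd) (st : astate) : Prop :=
  match c with
  | Asg r e => esafe st e /\ aeval st e <= V
  | Wr k e1 e2 =>
      [/\ esafe st e1 /\ esafe st e2, k < regions, aeval st e1 < S
        & aeval st e2 <= V]
  | Sq c1 c2 => safe c1 st /\ safe c2 (run c1 st)
  | For r c1 => forall i, i < n ->
      safe c1 (iteri i (fun i st' => set_reg (run c1 st') r i.+1)
                 (set_reg st r 0))
  end.

Lemma reg_run c st (r : nat) : r \notin set_regs c -> reg (run c st) r = reg st r.
Proof.
elim: c st => [q e|k e1 e2|c1 IH1 c2 IH2|q c IH] st //=.
- by rewrite inE /upd => /negPf ->.
- by rewrite mem_cat negb_or => /andP[r1 r2]; rewrite IH2 // IH1.
rewrite inE negb_or => /andP[/negPf rq rc].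
elim: (n) => [|i IHi] /=; first by rewrite /upd rq.
by rewrite {1}/upd rq IH.
Qed.

Lemma cell_run c st (k i : nat) : k \notin set_regions c -> cell (run c st) k i = cell st k i.
Proof.
elim: c st => [q e|k' e1 e2|c1 IH1 c2 IH2|q c IH] st //=.
- by rewrite inE => /negPf ->.
- by rewrite mem_cat negb_or => /andP[r1 r2]; rewrite IH2 // IH1.
by move=> kc; elim: (n) => [|j IHj] //=; rewrite IH.
Qed.

(** The conclusion pairs safety with an arbitrary [Q], so an inner loop is again a goal of this
    shape and one invariant serves both purposes. Whatever the body does not assign is preserved for
    free. *)
Lemma for_rule (Inv : nat -> astate -> Prop) (Q : Prop) (r : nat) c st :
  r \notin set_regs c ->
  Inv 0 (set_reg st r 0) ->
  (forall i st', i < n -> reg st' r = i ->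
     (forall q : nat, q \notin r :: set_regs c -> reg st' q = reg st q) ->
     (forall k j : nat, k \notin set_regions c -> cell st' k j = cell st k j) ->
     Inv i st' -> safe c st' /\ Inv i.+1 (set_reg (run c st') r i.+1)) ->
  (Inv n (run (For r c) st) -> Q) ->
  safe (For r c) st /\ Q.
Proof.
move=> rc Inv0 step Inv_n; pose it i :=
  iteri i (fun i st' => set_reg (run c st') r i.+1) (set_reg st r 0).
have it_ok i : i <= n -> [/\ reg (it i) r = i,
    forall q, q \notin r :: set_regs c -> reg (it i) q = reg st q,
    forall k j, k \notin set_regions c -> cell (it i) k j = cell st k j &
    Inv i (it i) /\ (0 < i -> safe c (it i.-1))].
  elim: i => [_|i IH lt_i].
    split=> //=; first by rewrite /upd eqxx.
    by move=> q; rewrite inE negb_or /upd => /andP[/negPf ->].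
  have [reg_r reg_q mem_k [Inv_i _]] := IH (ltnW lt_i).
  have [safe_i Inv_i1] := step _ _ lt_i reg_r reg_q mem_k Inv_i.
  split=> //=; first by rewrite /upd eqxx.
    move=> q; rewrite inE negb_or => /andP[/negPf qr qc].
    by rewrite /upd qr reg_run // reg_q // inE qr.
  by move=> k j kc; rewrite cell_run // mem_k.
split=> [i lt_i|]; last by apply: Inv_n; have [_ _ _ []] := it_ok n (leqnn n).
by have [_ _ _ [_ /(_ isT)]] := it_ok i.+1 lt_i.
Qed.

Variables (w kmax cmax : nat).
Hypotheses (n_le_V : n < V) (kmax_le_V : kmax <= V) (V_gt1 : 1 < V)
  (cmax_ge : 3 <= cmax) (V_lt_w : V ^ cmax < w).

Definition bounded (st : state) : Prop :=
  (forall r, regs st r <= V) /\ (forall a, cells st a <= V).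

(** If the operands are at most [p1] and [p2], both positive, their sum is at most [2 * (p1 * p2)];
    as [V] is at least 2, the unit of cost of the operator pays for the factor 2. *)
Lemma eval_le st e : bounded st -> max_const e <= V -> eval st e <= V ^ cost e.
Proof.
case=> le_regs le_cells.
have pexp m : V <= V ^ m.+1 by rewrite expnS leq_pmulr // expn_gt0 ltnW.
have bin e1 e2 v1 v2 v : v1 <= V ^ cost e1 -> v2 <= V ^ cost e2 ->
    v <= v1 + v2 \/ v <= v1 * v2 -> v <= V ^ (cost e1 + cost e2).+1.
  have: 0 < V ^ cost e1 by rewrite expn_gt0 ltnW.
  have: 0 < V ^ cost e2 by rewrite expn_gt0 ltnW.
  rewrite expnS expnD; move: (V ^ cost e1) (V ^ cost e2) => p1 p2 p1_gt0 p2_gt0.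
  move=> le1 le2 le_v.
  have : v1 * v2 <= p1 * p2 by apply: leq_mul.
  have : v1 + v2 <= 2 * (p1 * p2) by nia.
  have : 2 * (p1 * p2) <= V * (p1 * p2) by rewrite leq_mul2r V_gt1 orbT.
  lia.
have bool_le (b : bool) m : b <= V ^ m.+1.
  by rewrite (leq_trans _ (pexp m)) // (leq_trans (leq_b1 b)) // ltnW.
elim: e => [k|r|e1 IH1|e1 IH1 e2 IH2|e1 IH1 e2 IH2|e1 IH1 e2 IH2|e1 IH1 e2 IH2|e1 IH1 e2 IH2] /=.
- by rewrite expn1.
- by rewrite expn1.
- by move=> _; rewrite (leq_trans (le_cells _)).
- by rewrite geq_max => /andP[/IH1 le1 /IH2 le2]; apply: bin le1 le2 _; left.
- rewrite geq_max => /andP[/IH1 le1 /IH2 le2]; apply: bin le1 le2 _; left; lia.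
- by rewrite geq_max => /andP[/IH1 le1 /IH2 le2]; apply: bin le1 le2 _; right.
- by move=> _; apply: bool_le.
- by move=> _; apply: bool_le.
Qed.

Lemma eval_lt_w st e :
  bounded st -> max_const e <= V -> cost e <= cmax -> eval st e < w.
Proof.
move=> bst ke ce; rewrite (leq_ltn_trans (eval_le bst ke)) //.
by rewrite (leq_ltn_trans _ V_lt_w) // leq_pexp2l // ltnW.
Qed.

Definition refines (st : state) (ast : astate) : Prop :=
  [/\ forall r, regs st r = reg ast r, reg ast 0 = n, reg ast 1 = S,
      forall k i, k < regions -> i < S -> cells st (k * S + i) = cell ast k i
    & bounded st].

Lemma eval_expr_of st ast e :
  refines st ast -> esafe ast e -> eval st (expr_of e) = aeval ast e.
Proof.
case=> eq_regs _ eqS eq_mem _.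
elim: e => [k|r|k e1 IH1|e1 IH1 e2 IH2|e1 IH1 e2 IH2|e1 IH1 e2 IH2|e1 IH1 e2 IH2|e1 IH1 e2 IH2] //=;
  try by case=> /IH1 -> /IH2 ->.
by case=> /IH1 -> lt_k lt_i; rewrite eq_regs eqS eq_mem.
Qed.

Let m := regions * S.

Lemma region_lt k i : k < regions -> i < S -> k * S + i < m.
Proof. by rewrite /m => lt_k lt_i; nia. Qed.

Lemma fits_expr_of st ast e :
  refines st ast -> esafe ast e -> small_expr kmax cmax (expr_of e) ->
  fits m w st (expr_of e).
Proof.
move=> ref se /andP[ke ce]; have [eq_regs _ eqS _ bst] := ref.
have lt_w e' := @eval_lt_w st e' bst.
move: se (leq_trans ke kmax_le_V) ce; clear ke.
elim: e => [k|r|k e1 IH1|e1 IH1 e2 IH2|e1 IH1 e2 IH2|e1 IH1 e2 IH2|e1 IH1 e2 IH2|e1 IH1 e2 IH2];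
  move=> se ke ce; have := lt_w _ ke ce; move: se ke ce;
  rewrite -1?[expr_of _]/(expr_of _); try (
    move=> /= [s1 s2]; rewrite geq_max => /andP[k1 k2] ce ->;
    by rewrite IH1 ?IH2 //; lia).
- by move=> _ _ _ /= ->.
- by move=> _ _ _ /= ->.
move=> [s1 lt_k lt_i] ke ce; rewrite /= => ->.
have [k1 k2] : k <= V /\ max_const (expr_of e1) <= V.
  by move: ke => /=; lia.
have ce' : cost (expr_of e1) + 4 < cmax by move: ce => /=; lia.
rewrite (lt_w (address k (expr_of e1))) 1?(lt_w (Times (Const k) (Reg 1)))
  1?(lt_w (Const k)) 1?(lt_w (Reg 1)) /=; try lia.
rewrite /= IH1 //; last lia.
by rewrite (eval_expr_of ref s1) eq_regs eqS region_lt.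
Qed.

Lemma refines_set_reg st ast r v :
  refines st ast -> r != 0 -> r != 1 -> v <= V ->
  refines (State (upd (regs st) r v) (cells st)) (set_reg ast r v).
Proof.
case=> eq_regs eqn eqS eq_mem [le_regs le_cells] r0 r1 le_v.
split=> //=.
- by move=> q; rewrite /upd; case: eqP.
- by rewrite /upd eq_sym (negPf r0).
- by rewrite /upd eq_sym (negPf r1).
by split=> // q /=; rewrite /upd; case: eqP.
Qed.

Lemma exec_prog_of c st ast :
  small_cmd kmax cmax c -> 0 \notin set_regs c -> 1 \notin set_regs c ->
  refines st ast -> safe c ast ->
  exists st' t, [/\ exec m w (prog_of c) st st' t, t <= cmd_time n c
                  & refines st' (run c ast)].
Proof.
elim: c st ast => [r e|k e1 e2|c1 IH1 c2 IH2|r c IH] st ast.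
- move=> /= sm; rewrite !inE => r0 r1 ref [se le_v].
  exists (State (upd (regs st) r (eval st (expr_of e))) (cells st)), (cost (expr_of e)).+1.
  split=> //; first by apply: ExecAssign; apply: fits_expr_of ref _ _.
  by rewrite (eval_expr_of ref se); apply: refines_set_reg; rewrite // eq_sym.
- move=> /= /andP[sm1 sm2] _ _ ref [[s1 s2] lt_k lt_i le_v].
  have [eq_regs eqn eqS eq_mem [le_regs le_cells]] := ref.
  do 2 eexists; split.
  + apply: ExecWrite; last exact: fits_expr_of ref _ _.
      have /andP[ke ce] := sm1.
      have ke1 : max_const (expr_of e1) <= kmax by move: ke => /=; lia.
      have ce1 : cost (expr_of e1) <= cmax by move: ce => /=; lia.
      have fit1 : fits m w st (expr_of e1).
        by apply: fits_expr_of ref _ _ => //; apply/andP.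
      have lt_w := @eval_lt_w st _ (conj le_regs le_cells).
      rewrite /= fit1 andbT.
      rewrite (lt_w (address k (expr_of e1))) 1?(lt_w (Times (Const k) (Reg 1)))
        1?(lt_w (Const k)) 1?(lt_w (Reg 1)) /=; move: ke ce => /=; lia.
    by rewrite /= (eval_expr_of ref s1) eq_regs eqS region_lt.
  + by [].
  rewrite (eval_expr_of ref s2) /= (eval_expr_of ref s1) eq_regs eqS.
  split=> //= [k' j lt_k' lt_j|].
    rewrite /upd eq_mem //; case: ifP => [/eqP|] E.
      by have [-> ->] := region_inj lt_j lt_i E; rewrite !eqxx.
    by case: ifP => // /andP[/eqP ek /eqP ej]; move: E; rewrite ek ej eqxx.
  by split=> // a /=; rewrite /upd; case: eqP.
- move=> /= /andP[sm1 sm2]; rewrite !mem_cat !negb_or => /andP[z1 z2] /andP[o1 o2].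
  move=> ref [s1 s2].
  have [st1 [t1 [ex1 le1 ref1]]] := IH1 _ _ sm1 z1 o1 ref s1.
  have [st2 [t2 [ex2 le2 ref2]]] := IH2 _ _ sm2 z2 o2 ref1 s2.
  by exists st2, (t1 + t2); split; [apply: ExecSeq ex1 ex2|lia|].
rewrite /= => /and4P[r0 r1 rc sm]; rewrite !inE !negb_or => /andP[_ zc] /andP[_ oc] ref safe_c.
pose it i := iteri i (fun i st' => set_reg (run c st') r i.+1) (set_reg ast r 0).
have reg_it i : reg (it i) r = i by case: i => [|i] /=; rewrite /upd eqxx.
have fit0 : fits m w st (Const 0).
  by rewrite /= andbT (leq_ltn_trans _ V_lt_w).
pose st0 := State (upd (regs st) r 0) (cells st).
have ref0 : refines st0 (it 0) by apply: refines_set_reg.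
have fit_test st1 i : refines st1 (it i) -> fits m w st1 (Less (Reg r) (Reg 0)).
  case=> _ _ _ _ b1; have lt_w := @eval_lt_w st1 _ b1.
  by rewrite /= (lt_w (Less (Reg r) (Reg 0))) ?(lt_w (Reg r)) ?(lt_w (Reg 0)) //=; lia.
have loop d i st1 : i + d = n -> refines st1 (it i) ->
    exists st' t, [/\ exec m w (While (Less (Reg r) (Reg 0))
           (Seq (prog_of c) (Assign r (Plus (Reg r) (Const 1))))) st1 st' t,
      t <= 4 + d * (cmd_time n c + 8) & refines st' (it n)].
  elim: d i st1 => [|d IHd] i st1 eq_n ref1; have [eq_regs eqn _ _ _] := ref1.
    have eq_i : i = n by lia.
    exists st1, 4; split=> //; last by rewrite -eq_i.
    apply: (@ExecWhileStop m w (Less (Reg r) (Reg 0))); first exact: fit_test ref1.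
    by rewrite /= !eq_regs eqn reg_it eq_i ltnn.
  have lt_i : i < n by lia.
  have [st2 [t2 [ex2 le2 ref2]]] := IH _ _ sm zc oc ref1 (safe_c i lt_i).
  pose st3 := State (upd (regs st2) r i.+1) (cells st2).
  have ref3 : refines st3 (it i.+1) by apply: refines_set_reg => //; lia.
  have reg2 : regs st2 r = i.
    by have [-> _ _ _ _] := ref2; rewrite reg_run ?reg_it.
  have ex3 : exec m w (Assign r (Plus (Reg r) (Const 1))) st2 st3 4.
    have -> : st3 = State (upd (regs st2) r (eval st2 (Plus (Reg r) (Const 1)))) (cells st2).
      by rewrite /= reg2 addn1.
    apply: (@ExecAssign m w r (Plus (Reg r) (Const 1))).
    have [_ _ _ _ b2] := ref2; have lt_w := @eval_lt_w st2 _ b2.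
    by rewrite /= (lt_w (Plus (Reg r) (Const 1))) ?(lt_w (Reg r)) ?(lt_w (Const 1)) //=; lia.
  have [st' [t' [ex' le' ref']]] := IHd i.+1 st3 (ltac:(lia)) ref3.
  exists st', (3 + (t2 + 4) + t').+1; split=> //; last by rewrite mulSn; lia.
  apply: (@ExecWhileLoop m w (Less (Reg r) (Reg 0))) ex'.
  - exact: fit_test ref1.
  - by rewrite /= !eq_regs eqn reg_it lt_i.
  exact: ExecSeq ex2 ex3.
have [st' [t [ex le_t ref']]] := loop n 0 st0 (ltac:(lia)) ref0.
exists st', (2 + t); split.
- by apply: ExecSeq ex; apply: (@ExecAssign m w r (Const 0)).
- by move: le_t; lia.
exact: ref'.
Qed.

End Machine.

(** * The algorithm *)

Section Unfolding.
Variables (regions n S V : nat) (st : astate).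
Local Notation run := (run n).
Local Notation safe := (safe regions n S V).
Local Notation esafe := (esafe regions S).

Lemma runE :
  ((forall r e, run (Asg r e) st = set_reg st r (aeval st e)) *
   (forall k e1 e2,
      run (Wr k e1 e2) st = set_mem st k (aeval st e1) (aeval st e2)) *
   (forall c1 c2, run (Sq c1 c2) st = run c2 (run c1 st)))%type.
Proof. by []. Qed.

Lemma safeE :
  ((forall r e, safe (Asg r e) st = (esafe st e /\ (aeval st e <= V)%N)) *
   (forall k e1 e2, safe (Wr k e1 e2) st =
      [/\ esafe st e1 /\ esafe st e2, (k < regions)%N, (aeval st e1 < S)%N
        & (aeval st e2 <= V)%N]) *
   (forall c1 c2, safe (Sq c1 c2) st = (safe c1 st /\ safe c2 (run c1 st))))%type.
Proof. by []. Qed.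

Lemma aevalE :
  ((forall k, aeval st (Cst k) = k) * (forall r, aeval st (Rg r) = reg st r) *
   (forall k e, aeval st (Rd k e) = cell st k (aeval st e)) *
   (forall e1 e2, aeval st (Add e1 e2) = (aeval st e1 + aeval st e2)%N) *
   (forall e1 e2, aeval st (Dif e1 e2) = (aeval st e1 - aeval st e2)%N) *
   (forall e1 e2, aeval st (Mul e1 e2) = (aeval st e1 * aeval st e2)%N) *
   (forall e1 e2, aeval st (Lt e1 e2) = (aeval st e1 < aeval st e2)%N :> nat) *
   (forall e1 e2, aeval st (Eq e1 e2) = (aeval st e1 == aeval st e2) :> nat))%type.
Proof. by []. Qed.

Lemma esafeE :
  ((forall k, esafe st (Cst k) = True) * (forall r, esafe st (Rg r) = True) *
   (forall k e, esafe st (Rd k e) = [/\ esafe st e, (k < regions)%N & (aeval st e < S)%N]) *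
   (forall e1 e2, esafe st (Add e1 e2) = (esafe st e1 /\ esafe st e2)) *
   (forall e1 e2, esafe st (Dif e1 e2) = (esafe st e1 /\ esafe st e2)) *
   (forall e1 e2, esafe st (Mul e1 e2) = (esafe st e1 /\ esafe st e2)) *
   (forall e1 e2, esafe st (Lt e1 e2) = (esafe st e1 /\ esafe st e2)) *
   (forall e1 e2, esafe st (Eq e1 e2) = (esafe st e1 /\ esafe st e2)))%type.
Proof. by []. Qed.

Lemma run_sq c1 c2 : run (Sq c1 c2) st = run c2 (run c1 st).
Proof. by []. Qed.

Lemma safe_sq c1 c2 : safe c1 st -> safe c2 (run c1 st) -> safe (Sq c1 c2) st.
Proof. by []. Qed.

End Unfolding.

Opaque run safe aeval esafe.

(* Locked so that unification does not unfold them into the rules above. *)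
Fact expr_key : unit. Proof. exact: tt. Qed.

Definition idx := locked_with expr_key
  (fun x v : aexpr => Add (Mul x (Rg 0)) v).

Lemma idxE x v : idx x v = Add (Mul x (Rg 0)) v.
Proof. by rewrite /idx unlock. Qed.

(** The input codes infinity by 0; adding [B] in that case makes it the largest entry, so that codes
    compare like distances. *)
Definition ent := locked_with expr_key (fun x v : aexpr =>
  Add (Rd 0 (idx x v)) (Mul (Eq (Rd 0 (idx x v)) (Cst 0)) (Rg 2))).

Lemma entE x v :
  ent x v = Add (Rd 0 (idx x v)) (Mul (Eq (Rd 0 (idx x v)) (Cst 0)) (Rg 2)).
Proof. by rewrite /ent unlock. Qed.

Definition emax (e1 e2 : aexpr) : aexpr := Add e1 (Dif e2 e1).
Definition emin (e1 e2 : aexpr) : aexpr := Dif e1 (Dif e1 e2).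
Definition enot (e : aexpr) : aexpr := Dif (Cst 1) e.

(* Regions: 0 the matrix; 1 the predecessors plus one, 0 meaning none; 2 the
   ranks in the current column; 3 and 4 the prefix maxima of [D x a] and of
   [B - D x a], [B] being the code of infinity; 5 the output triples.
   Registers: 0 holds [n], 1 the region size, 2 holds [B], 3 to 6 are loop
   counters, 9 is the number of triples, 13 the answer. *)
Definition max_entry : cmd :=
  For 3 (For 4 (Asg 2 (emax (Rg 2) (Rd 0 (idx (Rg 3) (Rg 4)))))).

Definition calc_inf : cmd :=
  Sq (Asg 2 (Cst 0)) (Sq max_entry (Asg 2 (Add (Rg 2) (Cst 1)))).

Definition rank_acc : cmd :=
  For 6 (Asg 7 (Add (Rg 7)
    (enot (Lt (ent (Rg 5) (Rg 3)) (ent (Rg 6) (Rg 3)))))).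

Definition rank_col : cmd :=
  For 5 (Sq (Asg 7 (Cst 0)) (Sq rank_acc (Wr 2 (Rg 5) (Rg 7)))).

(** The array has [n + 1] cells but a loop makes [n] rounds, so cell 0 is treated apart. *)
Definition clear (k : nat) : cmd :=
  Sq (Wr k (Cst 0) (Cst 0)) (For 5 (Wr k (Add (Rg 5) (Cst 1)) (Cst 0))).

Definition bucket (k : nat) (g h : aexpr) : cmd :=
  For 5 (Wr k g (emax (Rd k g) h)).

Definition sweep_max (k : nat) : cmd :=
  For 5 (Wr k (Add (Rg 5) (Cst 1))
           (emax (Rd k (Rg 5)) (Rd k (Add (Rg 5) (Cst 1))))).

Definition prefix_max (k : nat) (g h : aexpr) : cmd :=
  Sq (clear k) (Sq (bucket k g h) (sweep_max k)).

(** The minimum of [D x a] over ranks above [r] becomes a maximum of [B - D x a] over reversed ranks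
    [n + 1 - rank], read at [n - r]. In place of a branch, the flag in register 8 selects the new or
    the old value. *)
Definition mark : cmd :=
  For 5 (Sq
    (Asg 8
       (Mul (Mul (Lt (ent (Rg 5) (Rg 4)) (ent (Rg 5) (Rg 3)))
                 (Lt (ent (Rg 5) (Rg 3)) (Rg 2)))
            (Mul (enot (Lt (ent (Rg 5) (Rg 3)) (Rd 3 (Rd 2 (Rg 5)))))
                 (Lt (Rd 4 (Dif (Rg 0) (Rd 2 (Rg 5))))
                     (Dif (Rg 2) (ent (Rg 5) (Rg 3)))))))
    (Wr 1 (idx (Rg 5) (Rg 3))
       (Add (Mul (Rg 8) (Add (Rg 4) (Cst 1)))
            (Mul (enot (Rg 8)) (Rd 1 (idx (Rg 5) (Rg 3))))))).

Definition try_pred : cmd :=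
  Sq (prefix_max 3 (Rd 2 (Rg 5)) (ent (Rg 5) (Rg 4)))
    (Sq (prefix_max 4 (Dif (Add (Rg 0) (Cst 1)) (Rd 2 (Rg 5)))
           (Dif (Rg 2) (ent (Rg 5) (Rg 4))))
        mark).

Definition find_preds : cmd := For 3 (Sq rank_col (For 4 try_pred)).

Definition all_preds : cmd :=
  For 3 (For 4 (Asg 13 (Mul (Rg 13)
    (enot (Mul (Mul (enot (Eq (Rg 3) (Rg 4))) (Lt (ent (Rg 3) (Rg 4)) (Rg 2)))
               (Eq (Rd 1 (idx (Rg 3) (Rg 4))) (Cst 0))))))).

(** An earlier pair yields the same triple only if it has the same time and either the same target
    and predecessor, with a smaller source, or the two swapped, in an earlier column. Two columns
    suffice, so the scan is linear. *)
Definition scan_dup : cmd :=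
  For 5 (Asg 12 (Mul (Rg 12) (Mul
    (enot (Mul (Mul (Eq (ent (Rg 5) (Rg 3)) (Rg 11))
                    (Eq (Rd 1 (idx (Rg 5) (Rg 3))) (Add (Rg 10) (Cst 1))))
               (Lt (Rg 5) (Rg 4))))
    (enot (Mul (Mul (Eq (ent (Rg 5) (Rg 10)) (Rg 11))
                    (Eq (Rd 1 (idx (Rg 5) (Rg 10))) (Add (Rg 3) (Cst 1))))
               (Lt (Rg 10) (Rg 3))))))).

(* The triple is always written but only counted, in register 9, if it is new. *)
Definition put : cmd :=
  Sq (Wr 5 (Mul (Cst 3) (Rg 9)) (emin (Rg 3) (Rg 10)))
  (Sq (Wr 5 (Add (Mul (Cst 3) (Rg 9)) (Cst 1)) (emax (Rg 3) (Rg 10)))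
  (Sq (Wr 5 (Add (Mul (Cst 3) (Rg 9)) (Cst 2)) (Dif (Rg 11) (Cst 1)))
      (Asg 9 (Add (Rg 9) (Rg 12))))).

(** Without a predecessor, truncation leaves 0 in register 10, still a valid vertex, and register 12
    is 0, so the triple is not counted. *)
Definition emit_one : cmd :=
  Sq (Asg 10 (Dif (Rd 1 (idx (Rg 4) (Rg 3))) (Cst 1)))
  (Sq (Asg 11 (ent (Rg 4) (Rg 3)))
  (Sq (Asg 12 (Lt (Cst 0) (Rd 1 (idx (Rg 4) (Rg 3)))))
  (Sq scan_dup put))).

Definition emit : cmd := For 3 (For 4 emit_one).

Definition main : cmd :=
  Sq calc_inf (Sq find_preds (Sq (Asg 13 (Cst 1)) (Sq all_preds
    (Sq (Asg 9 (Cst 0)) emit)))).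

Lemma bigmax_natP n (f : nat -> nat) m :
  reflect (forall i, i < n -> f i <= m) (\max_(0 <= i < n) f i <= m).
Proof.
apply: (iffP (bigmax_leqP_seq _ _ _ _)) => le_m i.
  by move=> lt_i; apply: le_m; rewrite ?mem_index_iota.
by rewrite mem_index_iota => lt_i _; apply: le_m.
Qed.

(** * Correctness of the algorithm *)

Section Verification.
Variables (n S V : nat) (enc : nat -> nat -> nat).

Definition infty : nat := (\max_(0 <= x < n) \max_(0 <= v < n) enc x v).+1.
Local Notation B := infty.

Hypothesis S_ge : 3 * (n * n) + n + 2 <= S.
Hypothesis S_le_V : S <= V.
Hypothesis B_le_V : B <= V.

Local Notation safe := (safe 6 n S V).
Local Notation esafe := (esafe 6 S).
Local Notation run := (run n).

Definition dist (x v : nat) : nat := enc x v + (enc x v == 0) * B.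
Local Notation F := dist.

Definition base (st : astate) : Prop :=
  [/\ reg st 0 = n, reg st 2 = B &
      forall x v, x < n -> v < n -> cell st 0 (x * n + v) = enc x v].

Lemma idx_lt x v : x < n -> v < n -> x * n + v < n * n.
Proof. by move=> lt_x lt_v; nia. Qed.

Lemma idx_eq x v x' v' : v < n -> v' < n ->
  (x * n + v == x' * n + v') = (x == x') && (v == v').
Proof.
move=> lt_v lt_v'; apply/eqP/andP => [/(region_inj lt_v lt_v')[-> ->] //|].
by case=> /eqP -> /eqP ->.
Qed.

Lemma enc_lt x v : x < n -> v < n -> enc x v < B.
Proof.
move=> lt_x lt_v; rewrite ltnS.
have /bigmax_natP/(_ v lt_v) := leqnn (\max_(0 <= y < n) enc x y).
move=> /leq_trans; apply.
by have /bigmax_natP/(_ x lt_x) := leqnn (\max_(0 <= x < n) \max_(0 <= v < n) enc x v).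
Qed.

Lemma dist_le x v : x < n -> v < n -> F x v <= B.
Proof. by move=> lt_x lt_v; have := enc_lt lt_x lt_v; rewrite /F; case: eqP => [->|]; lia. Qed.

Lemma dist_gt0 x v : 0 < F x v.
Proof. by rewrite /F; case: (enc x v) => [|k]; rewrite ?add0n ?mul1n ?addSn. Qed.

Lemma base_frame st st' :
  reg st' 0 = reg st 0 -> reg st' 2 = reg st 2 ->
  (forall j, cell st' 0 j = cell st 0 j) -> base st -> base st'.
Proof.
move=> r0 r2 m0 [b0 b2 bm]; split; rewrite ?r0 ?r2 // => x v lt_x lt_v.
by rewrite m0 bm.
Qed.

Lemma base_run c st :
  0 \notin set_regs c -> 2 \notin set_regs c -> 0 \notin set_regions c ->
  base st -> base (run c st).
Proof. by move=> h0 h2 hm; apply: base_frame => [||j]; rewrite ?reg_run ?cell_run. Qed.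

Lemma idx_ok st ex ev :
  base st -> esafe st ex -> esafe st ev -> aeval st ex < n -> aeval st ev < n ->
  [/\ esafe st (idx ex ev), aeval st (idx ex ev) = aeval st ex * n + aeval st ev
    & aeval st (idx ex ev) < S].
Proof.
case=> r0 _ _ sx sv lt_x lt_v; rewrite idxE !(esafeE, aevalE) r0; split=> //.
by have := idx_lt lt_x lt_v; lia.
Qed.

Lemma ent_ok st ex ev :
  base st -> esafe st ex -> esafe st ev -> aeval st ex < n -> aeval st ev < n ->
  esafe st (ent ex ev) /\ aeval st (ent ex ev) = F (aeval st ex) (aeval st ev).
Proof.
move=> bst sx sv lt_x lt_v; have [_ r2 bm] := bst.
have [si ei lt_i] := idx_ok bst sx sv lt_x lt_v.
rewrite entE; move: (idx ex ev) si ei lt_i => i si ei lt_i.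
by rewrite !esafeE !aevalE !ei bm // r2 -ei; do !split.
Qed.

Lemma max_addB a b : a + (b - a) = maxn a b.
Proof. lia. Qed.

Lemma calc_infP st :
  reg st 0 = n ->
  (forall x v, x < n -> v < n -> cell st 0 (x * n + v) = enc x v) ->
  safe calc_inf st /\ reg (run calc_inf st) 2 = B.
Proof.
move=> r0 bm.
pose row x k := \max_(0 <= v < k) enc x v.
pose rows i := \max_(0 <= x < i) row x n.
pose st1 := set_reg st 2 0.
have [s2 [e2 lt2]] : safe max_entry st1 /\
    (reg (run max_entry st1) 2 = rows n /\ reg (run max_entry st1) 2 < B).
  apply: (@for_rule _ _ _ _ (fun i s => reg s 2 = rows i /\ reg s 2 < B)) => //.
    by rewrite /= /upd /= /rows big_nil.
  move=> i st2 lt_i r3 fr fm [e2 lt2].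
  apply: (@for_rule _ _ _ _ (fun j s => reg s 2 = maxn (rows i) (row i j) /\ reg s 2 < B)) => //.
  - by rewrite /= /upd /= /row big_nil maxn0.
  - move=> j st3 lt_j r4 fr' fm' [e3 lt3].
    have lt_e := enc_lt lt_i lt_j.
    have [r0' r3'] : reg st3 0 = n /\ reg st3 3 = i by rewrite !fr' // fr.
    have e_ij : cell st3 0 (i * n + j) = enc i j by rewrite fm' // fm // bm.
    rewrite runE safeE /emax idxE !(esafeE, aevalE) r4 r0' r3' e_ij max_addB /= /upd /=.
    split; first by do !split=> //; have := idx_lt lt_i lt_j; lia.
    by split; [rewrite e3 [in RHS]/row big_nat_recr //= maxnA|lia].
  case=> e3 lt3; rewrite /= /upd /=.
  by rewrite {1}/rows big_nat_recr.
rewrite /calc_inf !(safeE, runE, aevalE, esafeE) -/st1 /= /upd /= e2 addn1.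
by do !split=> //; lia.
Qed.

Definition rank (b x : nat) : nat := \sum_(0 <= y < n) (F y b <= F x b).

Lemma count_le (p : nat -> bool) i : \sum_(0 <= y < i) p y <= i.
Proof.
by rewrite (leq_trans (leq_sum _ (fun y _ => leq_b1 _))) // sum_nat_const_nat; lia.
Qed.

Lemma rank_accP st x b :
  base st -> reg st 3 = b -> b < n -> reg st 5 = x -> x < n -> reg st 7 = 0 ->
  safe rank_acc st /\ reg (run rank_acc st) 7 = rank b x.
Proof.
move=> bst r3 lt_b r5 lt_x r7.
apply: (@for_rule _ _ _ _ (fun i s => reg s 7 = \sum_(0 <= y < i) (F y b <= F x b))) => //.
  by rewrite /= /upd /= r7 big_nil.
move=> i st2 lt_i r6 fr fm e7.
have bst2 : base st2 by apply: base_frame bst => [||j]; rewrite ?fr ?fm.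
have [r5' r3'] : reg st2 5 = x /\ reg st2 3 = b by rewrite !fr.
have [|||| s1 e1] := @ent_ok st2 (Rg 5) (Rg 3) bst2; rewrite ?aevalE ?r5' ?r3' //.
have [|||| s2 e2] := @ent_ok st2 (Rg 6) (Rg 3) bst2; rewrite ?aevalE ?r6 ?r3' //.
rewrite safeE runE /enot !esafeE !aevalE e1 e2 !aevalE r5' r3' r6 e7 /= /upd /=.
rewrite big_nat_recr //=.
have -> : 1 - (F x b < F i b) = (F i b <= F x b) by rewrite ltnNge; case: leqP.
split=> //; split=> //.
have := count_le (fun y => F y b <= F x b) i; have := leq_b1 (F i b <= F x b); lia.
Qed.

Lemma rank_colP st b :
  base st -> reg st 3 = b -> b < n ->
  safe rank_col st /\ forall x, x < n -> cell (run rank_col st) 2 x = rank b x.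
Proof.
move=> bst r3 lt_b.
apply: (@for_rule _ _ _ _ (fun i s => forall x, x < i -> cell s 2 x = rank b x)) => //.
move=> i st2 lt_i r5 fr fm e2.
pose st3 := set_reg st2 7 0.
have bst3 : base st3 by apply: base_frame bst => [||j] /=; rewrite /upd /= ?fr ?fm.
have r3' : reg st3 3 = b by rewrite /st3 /= /upd /= fr.
have [s7 e7] := rank_accP bst3 r3' lt_b r5 lt_i (erefl _).
rewrite !(safeE, runE, aevalE, esafeE) -/st3 e7 reg_run //= /upd /= r5.
split.
  do !split=> //; first by lia.
  have := count_le (fun y => F y b <= F i b) n; rewrite /rank; lia.
move=> x; rewrite ltnS cell_run //=.
by case: eqP => [->|neq] // le_x; apply: e2; lia.
Qed.

Lemma clearP k st :
  reg st 0 = n -> k < 6 ->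
  safe (clear k) st /\ forall r, r <= n -> cell (run (clear k) st) k r = 0.
Proof.
move=> r0 lt_k.
have [s2 e2] : safe (For 5 (Wr k (Add (Rg 5) (Cst 1)) (Cst 0))) (set_mem st k 0 0) /\
    forall r, r <= n -> cell (run (For 5 (Wr k (Add (Rg 5) (Cst 1)) (Cst 0))) (set_mem st k 0 0)) k r = 0.
  apply: (@for_rule _ _ _ _ (fun i s => forall r, r <= i -> cell s k r = 0)) => //.
    by move=> r; rewrite leqn0 => /eqP -> /=; rewrite !eqxx.
  move=> i st2 lt_i r5 fr fm e2; rewrite !(safeE, runE, aevalE, esafeE) r5 addn1 /=.
  split; first by do !split=> //=; lia.
  move=> r le_r; rewrite eqxx.
  by case: eqP => [->|neq] //=; apply: e2; lia.
rewrite /clear !(safeE, runE, aevalE, esafeE).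
by do !split=> //=; lia.
Qed.

(** Indices outside the range contribute 0, neutral for the maximum and equal to the content of a
    cleared cell. *)
Definition bucket_max (g h : nat -> nat) i r := \max_(0 <= x < i) ((g x == r) * h x).
Definition below_max (g h : nat -> nat) r := \max_(0 <= x < n) ((g x <= r) * h x).

Lemma below_max0 g h : below_max g h 0 = bucket_max g h n 0.
Proof. by apply: eq_bigr => x _; rewrite leqn0. Qed.

Lemma below_maxS g h r :
  below_max g h r.+1 = maxn (below_max g h r) (bucket_max g h n r.+1).
Proof.
rewrite /below_max /bucket_max; elim: (n) => [|i IH]; first by rewrite !big_nil.
rewrite !big_nat_recr //= IH.
move: (\max_(0 <= x < i) _) (\max_(0 <= x < i) _) => m1 m2.
have -> : (g i <= r.+1) = (g i <= r) || (g i == r.+1) by lia.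
case: (leqP (g i) r) => gr; case: (eqVneq (g i) r.+1) => ge /=; rewrite ?mul0n ?mul1n; lia.
Qed.

Section PrefixMax.
Variables (k : nat) (g h : nat -> nat) (eg eh : aexpr) (st : astate).
Hypotheses (r0 : reg st 0 = n) (lt_k : k < 6).
Hypothesis g_le : forall x, x < n -> g x <= n.
Hypothesis h_le : forall x, x < n -> h x <= V.
Hypothesis egh_ok : forall st' x, x < n -> reg st' 5 = x ->
  (forall q, q != 5 -> reg st' q = reg st q) ->
  (forall k' j, k' != k -> cell st' k' j = cell st k' j) ->
  [/\ esafe st' eg, esafe st' eh, aeval st' eg = g x & aeval st' eh = h x].

Lemma prefix_maxP :
  safe (prefix_max k eg eh) st /\
  forall r, r <= n -> cell (run (prefix_max k eg eh) st) k r = below_max g h r.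
Proof.
have [s1 e1] := clearP r0 lt_k.
pose st1 := run (clear k) st.
have bm_le i r : i <= n -> bucket_max g h i r <= V.
  move=> le_i; apply/bigmax_natP => x lt_x.
  by case: eqP; rewrite ?mul0n ?mul1n ?h_le //; lia.
have [s2 e2] : safe (bucket k eg eh) st1 /\
    forall r, r <= n -> cell (run (bucket k eg eh) st1) k r = bucket_max g h n r.
  apply: (@for_rule _ _ _ _ (fun i s => forall r, r <= n -> cell s k r = bucket_max g h i r)) => //.
    by move=> r le_r /=; rewrite e1 // /bucket_max big_nil.
  move=> i st2 lt_i r5 fr fm e2.
  have [||sg sh eg_i eh_i] := egh_ok lt_i r5.
  - by move=> q q5; rewrite fr ?inE ?(negPf q5) // reg_run ?inE.
  - by move=> k' j kk; rewrite fm ?inE // cell_run // !inE (negPf kk).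
  have g_i := g_le lt_i.
  rewrite !(safeE, runE) /emax !(aevalE, esafeE) eg_i eh_i e2 // max_addB /=.
  have -> : maxn (bucket_max g h i (g i)) (h i) = bucket_max g h i.+1 (g i).
    by rewrite [RHS]/bucket_max big_nat_recr //= eqxx mul1n.
  split; first by do !split=> //; rewrite ?bm_le //; lia.
  move=> r le_r; rewrite eqxx; case: eqP => [->|neq] //=.
  rewrite e2 // [RHS]/bucket_max big_nat_recr //=.
  by case: eqP => [/esym//|_]; rewrite mul0n maxn0.
pose st2 := run (bucket k eg eh) st1.
have [s3 e3] : safe (sweep_max k) st2 /\
    forall r, r <= n -> cell (run (sweep_max k) st2) k r = below_max g h r.
  apply: (@for_rule _ _ _ _ (fun i s => forall r, r <= n -> cell s k r =
      if r <= i then below_max g h r else bucket_max g h n r)) => //.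
  - move=> r le_r /=; rewrite e2 // leqn0.
    by case: eqP => [->|//]; rewrite below_max0.
  - move=> i st3 lt_i r5 fr fm e3.
    have bel_le r : below_max g h r <= V.
      apply/bigmax_natP => x lt_x.
      by case: (g x <= r); rewrite ?mul0n ?mul1n // h_le.
    rewrite !(safeE, runE) /emax !(aevalE, esafeE) r5 addn1 !e3 ?(ltnW lt_i) //.
    rewrite leqnn ltnn max_addB -below_maxS /=.
    split; first by do !split=> //; lia.
    move=> r le_r; rewrite eqxx; case: eqP => [->|neq] /=; first by rewrite leqnn.
    by rewrite e3 //; have -> : (r <= i) = (r <= i.+1) by lia.
  by move=> e3 r le_r; rewrite e3 // le_r.
by rewrite /prefix_max !(safeE, runE).
Qed.

End PrefixMax.

Lemma rank_max b x : rank b x <= n.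
Proof. exact: count_le. Qed.

(** Ties share a rank. If [F u b < F x b], then [x] counts itself in its own rank but is not counted
    in that of [u], which makes the inequality of ranks strict. *)
Lemma rank_le b x u : x < n -> (rank b x <= rank b u) = (F x b <= F u b).
Proof.
move=> lt_x; case: (leqP (F x b) (F u b)) => [le_xu|lt_ux].
  apply: leq_sum => y _.
  by case: (leqP (F y b) (F x b)) => // /leq_trans/(_ le_xu) ->.
apply/negbTE; rewrite -ltnNge /rank.
have -> : (\sum_(0 <= y < n) (F y b <= F u b)).+1 =
    \sum_(0 <= y < n) ((F y b <= F u b) + (y == x)).
  rewrite big_split /= (_ : \sum_(0 <= y < n) (y == x) = 1) ?addn1 //.
  rewrite (bigD1_seq x) ?mem_index_iota ?iota_uniq //= eqxx big1 // => y.
  by move/negPf ->.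
apply: leq_sum => y _; case: eqP => [->|_]; first by rewrite leqnn (leqNgt (F x b)) lt_ux.
by rewrite addn0; case: (leqP (F y b) (F u b)) => // /leq_trans/(_ (ltnW lt_ux)) ->.
Qed.

Definition is_pred (u a b : nat) : bool :=
  [&& F u a < F u b, F u b < B &
      all (fun x => (F x a <= F u b) == (F x b <= F u b)) (iota 0 n)].

Lemma is_pred_test u a b : u < n -> a < n -> b < n ->
  [&& F u a < F u b, F u b < B,
      below_max (rank b) (F^~ a) (rank b u) <= F u b &
      below_max (fun x => n.+1 - rank b x) (fun x => B - F x a) (n - rank b u)
        < B - F u b] = is_pred u a b.
Proof.
move=> lt_u lt_a lt_b; rewrite /is_pred.
case: (F u a < F u b) => //=; case: ltnP => //= lt_B.
have -> : B - F u b = (B - F u b).-1.+1 by lia.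
rewrite ltnS; apply/andP/allP => [[/bigmax_natP le1 /bigmax_natP le2] x|eq_ab].
  rewrite mem_iota /= add0n => lt_x; apply/eqP.
  have := le1 _ lt_x; have := le2 _ lt_x; rewrite rank_le //.
  have -> : (n.+1 - rank b x <= n - rank b u) = ~~ (F x b <= F u b).
    by rewrite -rank_le //; have := rank_max b x; have := rank_max b u; lia.
  by have := dist_le lt_x lt_a; case: (leqP (F x b)) => _ /=; lia.
split; apply/bigmax_natP => x lt_x.
  have := eq_ab x; rewrite rank_le // mem_iota add0n lt_x => /(_ isT)/eqP.
  by case: (leqP (F x b)) => _; rewrite ?mul1n ?mul0n.
have -> : (n.+1 - rank b x <= n - rank b u) = ~~ (F x b <= F u b).
  by rewrite -rank_le //; have := rank_max b x; have := rank_max b u; lia.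
have := eq_ab x; rewrite mem_iota add0n lt_x => /(_ isT)/eqP.
by case: (leqP (F x b)) => _ /=; rewrite ?mul1n ?mul0n; lia.
Qed.

Lemma markP st a b :
  base st -> reg st 3 = b -> b < n -> reg st 4 = a -> a < n ->
  (forall x, x < n -> cell st 2 x = rank b x) ->
  (forall r, r <= n -> cell st 3 r = below_max (rank b) (F^~ a) r) ->
  (forall r, r <= n -> cell st 4 r =
     below_max (fun x => n.+1 - rank b x) (fun x => B - F x a) r) ->
  (forall u, u < n -> cell st 1 (u * n + b) <= n) ->
  safe mark st /\ forall u v, u < n -> v < n ->
    cell (run mark st) 1 (u * n + v) =
    if (v == b) && is_pred u a b then a.+1 else cell st 1 (u * n + v).
Proof.
move=> bst r3 lt_b r4 lt_a c2 c3 c4 c1.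
apply: (@for_rule _ _ _ _ (fun i s => forall u v, u < n -> v < n ->
    cell s 1 (u * n + v) =
    if [&& u < i, v == b & is_pred u a b] then a.+1 else cell st 1 (u * n + v))) => //.
  move=> u st2 lt_u r5 fr fm e1.
  have bst2 : base st2 by apply: base_frame bst => [||j]; rewrite ?fr ?fm.
  have [r0' r2' _] := bst2.
  have [r3' r4'] : reg st2 3 = b /\ reg st2 4 = a by rewrite !fr.
  have [|||| s1 e_ua] := @ent_ok st2 (Rg 5) (Rg 4) bst2; rewrite ?aevalE ?r5 ?r4' //.
  have [|||| s2 e_ub] := @ent_ok st2 (Rg 5) (Rg 3) bst2; rewrite ?aevalE ?r5 ?r3' //.
  pose st3 := set_reg st2 8 (is_pred u a b).
  have bst3 : base st3 by apply: base_frame bst2.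
  have [|||| s3 e_i lt_i] := @idx_ok st3 (Rg 5) (Rg 3) bst3;
    rewrite ?aevalE /= /upd /= ?r5 ?r3' //.
  rewrite !(safeE, runE).
  set test := (Mul (Mul _ _) _).
  have le_u := rank_max b u.
  have [s_t e_t] : esafe st2 test /\ aeval st2 test = is_pred u a b.
    rewrite /test /enot !(esafeE, aevalE) e_ua e_ub !aevalE r5 r3' r4' r2' r0'.
    rewrite !fm // c2 // c3 // c4 ?leq_subr // -is_pred_test //.
    split; first by do !split=> //; lia.
    rewrite (leqNgt (below_max _ _ _)); case: (F u a < F u b); case: (F u b < B);
      by case: (F u b < below_max _ _ _); case: (below_max _ _ _ < _).
  clearbody test; rewrite e_t -/st3 /enot !(esafeE, aevalE) e_i /= /upd /= !aevalE /= /upd /= r5 r3' r4'.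
  rewrite e1 // ltnn /=.
  split.
    have := idx_lt lt_u lt_b; have := c1 _ lt_u.
    by do !split=> //; try lia; case: is_pred; rewrite /= ?mul0n ?mul1n; lia.
  move=> u' v' lt_u' lt_v'; rewrite idx_eq // e1 //.
  case: (eqVneq u' u) => [->|neq] /=; last first.
    by have -> : (u' < u.+1) = (u' < u) by lia.
  case: (eqVneq v' b) => [->|neq] /=; rewrite ?andbF // ltnS leqnn /=.
  by case: is_pred; rewrite /= ?mul0n ?mul1n ?addn0 // ?addn1.
by move=> e1 u v lt_u lt_v; rewrite e1 // lt_u.
Qed.

Lemma try_predP st a b :
  base st -> reg st 3 = b -> b < n -> reg st 4 = a -> a < n ->
  (forall x, x < n -> cell st 2 x = rank b x) ->
  (forall u, u < n -> cell st 1 (u * n + b) <= n) ->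
  safe try_pred st /\ forall u v, u < n -> v < n ->
    cell (run try_pred st) 1 (u * n + v) =
    if (v == b) && is_pred u a b then a.+1 else cell st 1 (u * n + v).
Proof.
move=> bst r3 lt_b r4 lt_a c2 c1; have [r0 r2 _] := bst.
have F_le x : x < n -> F x a <= V.
  by move=> lt_x; rewrite (leq_trans (dist_le lt_x lt_a)).
have [s1 e1] : safe (prefix_max 3 (Rd 2 (Rg 5)) (ent (Rg 5) (Rg 4))) st /\
    forall r, r <= n -> cell (run (prefix_max 3 (Rd 2 (Rg 5)) (ent (Rg 5) (Rg 4))) st) 3 r
      = below_max (rank b) (F^~ a) r.
  apply: prefix_maxP => // [x _|st' x lt_x r5 fr fm]; first exact: rank_max.
  have bst' : base st' by apply: base_frame bst => [||j]; rewrite ?fr ?fm.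
  have r4' : reg st' 4 = a by rewrite fr.
  have [|||| sx ex] := @ent_ok st' (Rg 5) (Rg 4) bst'; rewrite ?aevalE ?r5 ?r4' //.
  rewrite !(esafeE, aevalE) ex !aevalE r5 r4' fm // c2 //.
  by do !split=> //; lia.
set st1 := run _ st in e1 *.
have bst1 : base st1 by apply: base_run bst.
have [r0' r2' _] := bst1.
set eg := Dif (Add (Rg 0) (Cst 1)) (Rd 2 (Rg 5)).
set eh := Dif (Rg 2) (ent (Rg 5) (Rg 4)).
have [s2 e2] : safe (prefix_max 4 eg eh) st1 /\
    forall r, r <= n -> cell (run (prefix_max 4 eg eh) st1) 4 r
      = below_max (fun x => n.+1 - rank b x) (fun x => B - F x a) r.
  apply: prefix_maxP => // [x lt_x|x lt_x|st' x lt_x r5 fr fm].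
  (* Since [x] counts itself, its rank is at least 1 and the reversed rank is a valid index. *)
  - have : 0 < rank b x; last by lia.
    rewrite /rank (bigD1_seq x) ?mem_index_iota ?iota_uniq //=.
    by rewrite leqnn.
  - by rewrite (leq_trans (leq_subr _ _)).
  have bst' : base st' by apply: base_frame bst1 => [||j]; rewrite ?fr ?fm.
  have r4' : reg st' 4 = a by rewrite fr // reg_run.
  have [|||| sx ex] := @ent_ok st' (Rg 5) (Rg 4) bst'; rewrite ?aevalE ?r5 ?r4' //.
  have [r0'' r2'' _] := bst'.
  rewrite /eg /eh !(esafeE, aevalE) ex !aevalE r5 r4' fm // cell_run // c2 // r0'' r2'' addn1.
  by do !split=> //; lia.
set st2 := run (prefix_max 4 eg eh) st1 in e2 *.
have bst2 : base st2 by apply: base_run bst1.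
have [|||||||| s3 e3] := @markP st2 a b bst2 => //.
- by rewrite !reg_run.
- by rewrite !reg_run.
- by move=> x lt_x; rewrite !cell_run // c2.
- by move=> r le_r; rewrite cell_run // e1.
- by move=> u lt_u; rewrite !cell_run // c1.
split; first by apply: safe_sq s1 _; apply: safe_sq s2 _.
move=> u v lt_u lt_v.
rewrite /try_pred (run_sq _ _ (prefix_max 3 _ _)) (run_sq _ _ (prefix_max 4 _ _)).
by rewrite e3 // !cell_run.
Qed.

(** Candidates are tried in increasing order and each success overwrites the previous one, so the
    largest survives. *)
Fixpoint last_pred (u b a : nat) : nat :=
  if a is a'.+1 then if is_pred u a' b then a else last_pred u b a' else 0.

Lemma last_pred_le u b a : last_pred u b a <= a.
Proof. by elim: a => //= a IH; case: ifP => // _; apply: leqW. Qed.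

Definition pred_of (u b : nat) : nat := last_pred u b n.

Lemma pred_of_le u b : pred_of u b <= n.
Proof. exact: last_pred_le. Qed.

Lemma find_predsP st :
  base st -> (forall i, i < n * n -> cell st 1 i = 0) ->
  safe find_preds st /\ forall u v, u < n -> v < n ->
    cell (run find_preds st) 1 (u * n + v) = pred_of u v.
Proof.
move=> bst c1.
apply: (@for_rule _ _ _ _ (fun b s => forall u v, u < n -> v < n ->
    cell s 1 (u * n + v) = if v < b then pred_of u v else 0)) => //.
- by move=> u v lt_u lt_v /=; rewrite c1 // idx_lt.
- move=> b st2 lt_b r3 fr fm e1.
  have bst2 : base st2 by apply: base_frame bst => [||j]; rewrite ?fr ?fm.
  have [s2 e2] := rank_colP bst2 r3 lt_b.
  rewrite safeE runE; set st3 := run rank_col st2 in e2 *.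
  have bst3 : base st3 by apply: base_run bst2.
  have [s4 e4] : safe (For 4 try_pred) st3 /\ forall u v, u < n -> v < n ->
      cell (run (For 4 try_pred) st3) 1 (u * n + v) =
      if v < b then pred_of u v else if v == b then pred_of u v else 0.
    apply: (@for_rule _ _ _ _ (fun a s => forall u v, u < n -> v < n ->
      cell s 1 (u * n + v) =
        if v < b then pred_of u v else if v == b then last_pred u b a else 0)) => //.
    + by move=> u v lt_u lt_v /=; rewrite cell_run // e1 //=; case: (v < b) => //; case: (v == b).
    + move=> a st4 lt_a r4 fr' fm' e4.
      have bst4 : base st4 by apply: base_frame bst3 => [||j]; rewrite ?fr' ?fm'.
      have [||| s5 e5] := @try_predP st4 a b bst4 _ lt_b r4 lt_a.
      * by rewrite fr' // reg_run.
      * by move=> x lt_x; rewrite fm' // e2.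
      * by move=> u lt_u; rewrite e4 // ltnn eqxx (leq_trans (last_pred_le _ _ _)) // ltnW.
      split=> // u v lt_u lt_v; rewrite /= e5 // e4 //.
      by case: (eqVneq v b) => [->|//] /=; rewrite ltnn.
    move=> e4 u v lt_u lt_v; rewrite e4 //.
    by case: (eqVneq v b) => [->|].
  split=> // u v lt_u lt_v; rewrite /= e4 //.
  have -> : (v < b.+1) = (v == b) || (v < b) by lia.
  by case: (v < b); case: (v == b).
by move=> e1 u v lt_u lt_v; rewrite e1 // lt_v.
Qed.

Definition with_preds (st : astate) : Prop :=
  base st /\ forall u v, u < n -> v < n -> cell st 1 (u * n + v) = pred_of u v.

Lemma with_preds_frame st st' :
  reg st' 0 = reg st 0 -> reg st' 2 = reg st 2 ->
  (forall k j, k < 2 -> cell st' k j = cell st k j) ->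
  with_preds st -> with_preds st'.
Proof.
move=> r0 r2 eq_c [bst c1]; split=> [|u v lt_u lt_v]; last by rewrite eq_c ?c1.
by apply: base_frame bst => // j; apply: eq_c.
Qed.

Lemma pred_at_ok st eu ev u v :
  with_preds st -> esafe st eu -> esafe st ev ->
  aeval st eu = u -> aeval st ev = v -> u < n -> v < n ->
  [/\ esafe st (ent eu ev), aeval st (ent eu ev) = F u v,
      esafe st (Rd 1 (idx eu ev)) & aeval st (Rd 1 (idx eu ev)) = pred_of u v].
Proof.
move=> [bst c1] su sv eu_u ev_v lt_u lt_v.
have [|| s1 e1] := @ent_ok st eu ev bst su sv; rewrite ?eu_u ?ev_v //.
have [|| s2 e2 lt_i] := @idx_ok st eu ev bst su sv; rewrite ?eu_u ?ev_v //.
by rewrite !(esafeE, aevalE) e2 eu_u ev_v c1 // -eu_u -ev_v -e2; split.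
Qed.

Lemma all_iotaS (p : pred nat) i : all p (iota 0 i.+1) = all p (iota 0 i) && p i.
Proof. by rewrite -addn1 iotaD all_cat /= andbT. Qed.

Definition entry_ok (u v : nat) : bool :=
  [|| u == v, B <= F u v | 0 < pred_of u v].

Lemma all_predsP st :
  with_preds st -> reg st 13 = 1 ->
  safe all_preds st /\ reg (run all_preds st) 13 =
    all (fun u => all (entry_ok u) (iota 0 n)) (iota 0 n).
Proof.
move=> wst r13.
apply: (@for_rule _ _ _ _ (fun i s =>
  reg s 13 = all (fun u => all (entry_ok u) (iota 0 n)) (iota 0 i))) => //.
move=> u st2 lt_u r3 fr fm e2.
apply: (@for_rule _ _ _ _ (fun j s => reg s 13 =
  all (fun u => all (entry_ok u) (iota 0 n)) (iota 0 u)
  && all (entry_ok u) (iota 0 j))) => //.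
- by rewrite /= andbT -e2.
- move=> v st3 lt_v r4 fr' fm' e3.
  have r3' : reg st3 3 = u by rewrite fr'.
  have wst3 : with_preds st3.
    by apply: with_preds_frame wst => [||k j _]; rewrite ?fr' ?fm' // ?fr ?fm.
  have [_ r2 _] := wst3.1.
  have [||||||s1 e1 s2 e4] := @pred_at_ok st3 (Rg 3) (Rg 4) u v wst3; rewrite ?aevalE //.
  move: e4 s2; move: (Rd 1 _) => ep e4 s2.
  rewrite all_iotaS safeE runE /enot !(esafeE, aevalE) e1 e4 r2 r3' r4 e3 /= /upd /=.
  rewrite andbA; set b0 := (_ && all _ (iota 0 v)).
  have -> : b0 * (1 - (1 - (u == v)) * (F u v < B) * (pred_of u v == 0)) = b0 && entry_ok u v.
    rewrite /entry_ok lt0n (leqNgt B).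
    by case: b0; case: (u == v); case: (F u v < B); case: (pred_of u v == 0).
  by split=> //; do !split=> //; rewrite (leq_trans (leq_b1 _)) //; lia.
by move=> e3; rewrite all_iotaS /= /upd /= e3.
Qed.

Definition key (u v : nat) : nat * nat * nat :=
  (minn v (pred_of u v).-1, maxn v (pred_of u v).-1, (F u v).-1).

Lemma last_predP u v a : 0 < last_pred u v a ->
  (last_pred u v a).-1 < a /\ is_pred u (last_pred u v a).-1 v.
Proof.
elim: a => //= a IH; case: ifP => [pr _ //|_ /IH[lt_a pr]].
by split=> //; apply: leqW.
Qed.

Lemma pred_ofP u v : 0 < pred_of u v ->
  (pred_of u v).-1 < n /\ is_pred u (pred_of u v).-1 v.
Proof. exact: last_predP. Qed.

Lemma pred_of_gt0 u v a : a < n -> is_pred u a v -> 0 < pred_of u v.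
Proof.
rewrite /pred_of; elim: (n) => //= i IH; rewrite ltnS leq_eqVlt.
case: ifP => // npr /orP[/eqP -> pr|]; last exact: IH.
by rewrite pr in npr.
Qed.

Definition is_dup (u v x : nat) : bool :=
  let w := (pred_of u v).-1 in
  [&& F x v == F u v, pred_of x v == w + 1 & x < u] ||
  [&& F x w == F u v, pred_of x w == v + 1 & w < v].

Lemma scan_dupP st u v (b0 : bool) :
  with_preds st -> u < n -> v < n -> reg st 3 = v -> reg st 4 = u ->
  reg st 10 = (pred_of u v).-1 -> reg st 11 = F u v -> reg st 12 = b0 ->
  safe scan_dup st /\
  reg (run scan_dup st) 12 = b0 && all (fun x => ~~ is_dup u v x) (iota 0 n).
Proof.
move=> wst lt_u lt_v r3 r4 r10 r11 r12.
apply: (@for_rule _ _ _ _ (fun i s =>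
  reg s 12 = b0 && all (fun x => ~~ is_dup u v x) (iota 0 i))) => //.
  by rewrite /= andbT.
move=> x st2 lt_x r5 fr fm e2.
have wst2 : with_preds st2.
  by apply: with_preds_frame wst => [||k j _]; rewrite ?fr ?fm.
have lt_w : (pred_of u v).-1 < n by have := pred_of_le u v; lia.
have [r3' r4'] : reg st2 3 = v /\ reg st2 4 = u by rewrite !fr.
have [r10' r11'] : reg st2 10 = (pred_of u v).-1 /\ reg st2 11 = F u v by rewrite !fr.
have [||||||s1 e1 s1' e1'] := @pred_at_ok st2 (Rg 5) (Rg 3) x v wst2; rewrite ?aevalE //.
have [||||||s4 e4 s4' e4'] := @pred_at_ok st2 (Rg 5) (Rg 10) x (pred_of u v).-1 wst2;
  rewrite ?aevalE ?r10' //.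
move: e1' s1' e4' s4'; move: (Rd 1 _) (Rd 1 _) => ep ep' e1' s1' e4' s4'.
rewrite all_iotaS safeE runE /enot !(esafeE, aevalE) e1 e1' e4 e4' r3' r4' r5 r10' r11' e2 /= /upd /=.
rewrite andbA; set b := (_ && all _ _).
have -> : b * ((1 - (F x v == F u v) * (pred_of x v == (pred_of u v).-1 + 1) * (x < u))
    * (1 - (F x (pred_of u v).-1 == F u v) * (pred_of x (pred_of u v).-1 == v + 1)
           * ((pred_of u v).-1 < v))) = b && ~~ is_dup u v x.
  rewrite /is_dup; case: b; case: (F x v == _); case: (pred_of x v == _);
  case: (x < u); case: (F x _ == _); case: (pred_of x _ == _); by case: (_ < v).
by split=> //; do !split=> //; rewrite (leq_trans (leq_b1 _)) //; lia.
Qed.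

Definition triple_at (st : astate) (i : nat) : nat * nat * nat :=
  (cell st 5 (3 * i), cell st 5 (3 * i + 1), cell st 5 (3 * i + 2)).

Lemma reg_set_mem st k i x r : reg (set_mem st k i x) r = reg st r.
Proof. by []. Qed.

Lemma putP st (b : bool) v w t :
  reg st 9 < n * n -> reg st 3 = v -> reg st 10 = w -> reg st 11 = t ->
  reg st 12 = b -> v < n -> w < n -> t <= V ->
  [/\ safe put st, reg (run put st) 9 = reg st 9 + b &
      forall i, triple_at (run put st) i =
        if i == reg st 9 then (minn v w, maxn v w, t.-1) else triple_at st i].
Proof.
move=> lt_cnt r3 r10 r11 r12 lt_v lt_w le_t.
rewrite /put /emin /emax !(safeE, runE) !(reg_set_mem, safeE, runE, aevalE, esafeE).
rewrite r3 r10 r11 r12 max_addB subn1.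
have -> : v - (v - w) = minn v w by lia.
move: (reg st 9) lt_cnt => cnt lt_cnt.
split=> [||i]; rewrite ?/triple_at /= /upd //=.
  by have := leq_b1 b; do !split=> //; lia.
have -> : (3 * i == 3 * cnt) = (i == cnt) by lia.
have -> : (3 * i == 3 * cnt + 1) = false by lia.
have -> : (3 * i == 3 * cnt + 2) = false by lia.
have -> : (3 * i + 1 == 3 * cnt) = false by lia.
have -> : (3 * i + 1 == 3 * cnt + 1) = (i == cnt) by lia.
have -> : (3 * i + 1 == 3 * cnt + 2) = false by lia.
have -> : (3 * i + 2 == 3 * cnt + 2) = (i == cnt) by lia.
have -> : (3 * i + 2 == 3 * cnt + 1) = false by lia.
have -> : (3 * i + 2 == 3 * cnt) = false by lia.
by case: ifP.
Qed.

Definition emitted (st : astate) : seq (nat * nat * nat) :=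
  [seq triple_at st i | i <- iota 0 (reg st 9)].

(** Pairs are visited column by column. The bound on the count guarantees a free slot for the next
    triple, which is written even when it is not counted. *)
Definition emit_inv (v u : nat) (st : astate) : Prop :=
  [/\ uniq (emitted st), reg st 9 <= v * n + u &
      forall k, k \in emitted st <-> exists u' v',
        [/\ u' < n, v' < n, (v' < v) || ((v' == v) && (u' < u)),
            0 < pred_of u' v' & k = key u' v']].

(** As [F] is positive, equal keys have equal times, and the target and predecessor agree up to
    order. These two vertices differ because [F] strictly decreases towards the predecessor, so a
    swapped pair lies in a strictly earlier column. *)
Lemma is_dupP u v : u < n -> v < n -> 0 < pred_of u v ->
  ~~ all (fun x => ~~ is_dup u v x) (iota 0 n) <->
  exists u' v', [/\ u' < n, v' < n, (v' < v) || ((v' == v) && (u' < u)),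
                    0 < pred_of u' v' & key u v = key u' v'].
Proof.
move=> lt_u lt_v p_gt0; have [lt_w /and3P[lt_F _ _]] := pred_ofP p_gt0.
have neq_wv : (pred_of u v).-1 <> v by move=> E; move: lt_F; rewrite E ltnn.
rewrite -has_predC; split=> [/hasP[x]|[u' [v' [lt_u' lt_v' earlier p'_gt0 [e1 e2 e3]]]]].
  rewrite mem_iota /= add0n negbK => lt_x /orP[] /and3P[/eqP eF /eqP eP lt].
    exists x, v; rewrite eqxx lt orbT /key eP eF; split=> //; first by lia.
    by congr (_, _, _); lia.
  exists x, (pred_of u v).-1; rewrite lt /key eP eF; split=> //; first by lia.
  by congr (_, _, _); lia.
have := dist_gt0 u v; have := dist_gt0 u' v' => F1 F2.
apply/hasP; exists u'; rewrite ?mem_iota //= negbK /is_dup.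
have eF : F u' v' = F u v by lia.
have [[e_v e_w]|[e_v e_w]] : (v' = v /\ (pred_of u' v').-1 = (pred_of u v).-1) \/
    (v' = (pred_of u v).-1 /\ (pred_of u' v').-1 = v) by lia.
  apply/orP; left; move: eF earlier e_w p'_gt0; rewrite e_v => -> /= earlier e_w p'_gt0.
  by rewrite eqxx /=; lia.
apply/orP; right; move: eF earlier e_w p'_gt0; rewrite -e_v => -> earlier e_w p'_gt0.
rewrite eqxx /=; lia.
Qed.

Lemma emit_oneP st u v :
  with_preds st -> u < n -> v < n -> reg st 3 = v -> reg st 4 = u ->
  emit_inv v u st -> safe emit_one st /\ emit_inv v u.+1 (run emit_one st).
Proof.
move=> wst lt_u lt_v r3 r4 [uniq_L cnt_le mem_L].
set w := (pred_of u v).-1; set t := F u v; set b0 := 0 < pred_of u v.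
have lt_w : w < n by have := pred_of_le u v; lia.
have t_le : t <= B by apply: dist_le.
have cnt_lt : reg st 9 < n * n by have := idx_lt lt_v lt_u; lia.
pose st1 := set_reg st 10 w; pose st2 := set_reg st1 11 t; pose st3 := set_reg st2 12 b0.
have wst1 : with_preds st1 by apply: with_preds_frame wst.
have wst2 : with_preds st2 by apply: with_preds_frame wst.
have wst3 : with_preds st3 by apply: with_preds_frame wst.
have [||||||_ _ sp ep] := @pred_at_ok st (Rg 4) (Rg 3) u v wst; rewrite ?aevalE ?esafeE //.
have [||||||se1 ee1 _ _] := @pred_at_ok st1 (Rg 4) (Rg 3) u v wst1; rewrite ?aevalE ?esafeE //.
have [||||||_ _ sp2 ep2] := @pred_at_ok st2 (Rg 4) (Rg 3) u v wst2; rewrite ?aevalE ?esafeE //.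
have [s4 e4] := @scan_dupP st3 u v b0 wst3 lt_u lt_v r3 r4 (erefl _) (erefl _) (erefl _).
set st4 := run scan_dup st3 in e4; set b := (b0 && _) in e4.
have [r3' r10'] : reg st4 3 = v /\ reg st4 10 = w by rewrite !reg_run.
have [r11' r9'] : reg st4 11 = t /\ reg st4 9 = reg st 9 by rewrite !reg_run.
have [||s5 e9 e5] := @putP st4 b v w t _ r3' r10' r11' e4 lt_v lt_w; rewrite ?r9' //.
  exact: leq_trans t_le B_le_V.
rewrite r9' in e9 e5.
have safe_run : safe emit_one st /\ run emit_one st = run put st4.
  rewrite /emit_one; move: sp ep sp2 ep2; move: (Rd 1 _) (ent _ _) se1 ee1 (put) s5.
  move=> er ee se1 ee1 c s5 sp ep sp2 ep2.
  rewrite !(safeE, runE) !(esafeE, aevalE) ep subn1 -/w -/st1 ee1 -/st2 ep2 -/b0 -/st3.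
  by have := leq_b1 b0; do !split=> //; lia.
case: safe_run => safe_c ->; split=> //.
have eqL : emitted (run put st4) = if b then rcons (emitted st) (key u v) else emitted st.
  have eq_old : [seq triple_at (run put st4) i | i <- iota 0 (reg st 9)] = emitted st.
    apply/eq_in_map => i; rewrite mem_iota add0n e5 => /andP[_ lt_i].
    by rewrite ltn_eqF // /triple_at !cell_run.
  rewrite /emitted e9; case: (b) => /=; last by rewrite addn0.
  by rewrite addn1 -addn1 iotaD map_cat cats1 add0n /= e5 eqxx eq_old.
have dupP := is_dupP lt_u lt_v.
have b_new : b -> key u v \notin emitted st.
  rewrite /b => /andP[/dupP dupP' nodup]; apply/negP => /mem_L/dupP'.
  by rewrite nodup.
split.
- rewrite eqL; case: (b) b_new => // b_new.
  by rewrite rcons_uniq uniq_L b_new.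
- by rewrite e9; have := leq_b1 b; lia.
move=> k; rewrite eqL; split.
  have mono : k \in emitted st -> exists u' v',
      [/\ u' < n, v' < n, (v' < v) || ((v' == v) && (u' < u.+1)),
        0 < pred_of u' v' & k = key u' v'].
    move=> /mem_L[u' [v' [? ? earlier ? ?]]]; exists u', v'; split=> //.
    by lia.
  rewrite /b; case: (boolP b0) => //= b0_t; case: ifP => // _.
  rewrite mem_rcons inE => /orP[/eqP ->|//]; exists u, v; split=> //.
  by rewrite eqxx ltnSn orbT.
case=> u' [v' [lt_u' lt_v' earlier p_gt0 ->]].
have [old|[eu ev]] : (v' < v) || ((v' == v) && (u' < u)) \/ (u' = u /\ v' = v) by lia.
  have : key u' v' \in emitted st by apply/mem_L; exists u', v'.
  by case: (b) => //; rewrite mem_rcons inE => ->; rewrite orbT.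
move: p_gt0; rewrite eu ev => p_gt0.
case E: b; first by rewrite mem_rcons inE eqxx.
apply/mem_L; apply/dupP => //.
by move: E; rewrite /b /b0 p_gt0 /= => ->.
Qed.

Lemma emitP st :
  with_preds st -> reg st 9 = 0 -> safe emit st /\ emit_inv n 0 (run emit st).
Proof.
move=> wst r9.
apply: (@for_rule _ _ _ _ (fun v s => emit_inv v 0 s)) => //.
  split; rewrite /emitted /= /upd /= r9 //=.
  by move=> k; split=> // -[u' [v' [_ _]]]; lia.
move=> v st2 lt_v r3 fr fm inv2.
apply: (@for_rule _ _ _ _ (fun u s => emit_inv v u s)) => //.
- move=> u st3 lt_u r4 fr' fm' inv3.
  have r3' : reg st3 3 = v by rewrite fr'.
  apply: emit_oneP => //.
  apply: with_preds_frame wst => [||k j lt_k].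
  + by rewrite fr' // fr.
  + by rewrite fr' // fr.
  by rewrite fm' ?fm // !inE; lia.
move=> [uniq_L le_cnt mem_L]; split=> //; first by move: le_cnt; rewrite /= /upd /=; lia.
move=> k; split=> [/mem_L|] [u' [v' [? ? earlier ? ?]]].
  by exists u', v'; split=> //; lia.
by apply/mem_L; exists u', v'; split=> //; lia.
Qed.

Lemma mainP st :
  reg st 0 = n ->
  (forall x v, x < n -> v < n -> cell st 0 (x * n + v) = enc x v) ->
  (forall i, i < n * n -> cell st 1 i = 0) ->
  safe main st /\
  [/\ reg (run main st) 13 = all (fun u => all (entry_ok u) (iota 0 n)) (iota 0 n),
      uniq (emitted (run main st)), reg (run main st) 9 <= n * n &
      forall k, k \in emitted (run main st) <-> exists u v,
        [/\ u < n, v < n, 0 < pred_of u v & k = key u v]].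
Proof.
move=> r0 c0 c1.
have [s1 e1] := calc_infP r0 c0; set st1 := run calc_inf st in e1.
have bst1 : base st1.
  by split=> // [|x v lt_x lt_v]; rewrite ?reg_run ?cell_run ?c0.
have [|s2 e2] := @find_predsP st1 bst1; first by move=> i lt_i; rewrite cell_run ?c1.
set st2 := run find_preds st1 in e2.
have wst2 : with_preds st2 by split=> //; apply: base_run bst1.
pose st3 := set_reg st2 13 1.
have wst3 : with_preds st3 by apply: with_preds_frame wst2.
have [s4 e4] := @all_predsP st3 wst3 (erefl _).
set st4 := run all_preds st3 in e4.
pose st5 := set_reg st4 9 0.
have wst5 : with_preds st5.
  apply: with_preds_frame wst3 => [||k j _].
  - by rewrite -[LHS]/(reg st4 0) reg_run.
  - by rewrite -[LHS]/(reg st4 2) reg_run.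
  by rewrite -[LHS]/(cell st4 k j) cell_run.
have [s6 [uniq_L le_cnt mem_L]] := @emitP st5 wst5 (erefl _).
have safe_run : safe main st /\ run main st = run emit st5.
  rewrite /main; move: (calc_inf) (find_preds) (all_preds) (emit) @st1 @st2 @st3 @st4 @st5 s1 s2 s4 s6 {e1 bst1 e2 wst2 wst3 e4 wst5 uniq_L le_cnt mem_L}.
  move=> k1 k2 k3 k4 st1 st2 st3 st4 st5 s1 s2 s4 s6.
  rewrite !(safeE, runE) !(esafeE, aevalE) -/st1 -/st2 -/st3 -/st4 -/st5.
  by do !split=> //; lia.
case: safe_run => safe_c ->; split=> //; split=> //.
- by rewrite reg_run.
- by move: le_cnt; rewrite addn0.
move=> k; split=> [/mem_L[u [v []]]|[u [v [? ? ? ?]]]]; first by exists u, v.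
by apply/mem_L; exists u, v; split=> //; lia.
Qed.

End Verification.

(** * The instance given by a distance matrix *)

Lemma nth_allpairs (T1 T2 T3 : Type) (f : T1 -> T2 -> T3) x1 x2 x3 s1 s2 i j :
  i < size s1 -> j < size s2 ->
  nth x3 [seq f x y | x <- s1, y <- s2] (i * size s2 + j) =
  f (nth x1 s1 i) (nth x2 s2 j).
Proof.
move=> + lt_j; elim: s1 i => //= x s1 IH [_|i /IH IHi] /=; rewrite nth_cat size_map.
  by rewrite mul0n add0n lt_j (nth_map x2).
by rewrite mulSn -addnA ltnNge leq_addr /= addKn.
Qed.

Section Instance.
Variables (n : nat) (D : 'M[option nat]_n).
Hypothesis Ddist : distance_matrix D.

Definition input_at (x v : nat) : nat := cells (input D) (x * n + v).
Local Notation B := (infty n input_at).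
Local Notation F := (dist n input_at).
Local Notation pred_of := (pred_of n input_at).
Local Notation is_pred := (is_pred n input_at).
Local Notation key := (key n input_at).

Lemma input_atE (u v : 'I_n) : input_at u v = encode (D u v).
Proof.
rewrite /input_at /= -[X in u * X]size_enum_ord.
by rewrite (nth_allpairs _ u v) ?size_enum_ord // !nth_ord_enum.
Qed.

Lemma input_atD_lt (u v : 'I_n) t : D u v = Some t -> t.+1 < B.
Proof. by move=> Dt; have := enc_lt input_at (ltn_ord u) (ltn_ord v); rewrite input_atE Dt. Qed.

Lemma distE (u v : 'I_n) : F u v = if D u v is Some t then t.+1 else B.
Proof. by rewrite /F input_atE; case: (D u v) => [t|] /=; rewrite ?mul0n ?mul1n ?addn0. Qed.

(** The bound on [t] keeps the code [B] of infinity above the threshold. *)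
Lemma le_distE (u v : 'I_n) t : t.+1 < B -> (F u v <= t.+1) = le_time (D u v) t.
Proof. by move=> lt_B; rewrite distE; case: (D u v) => [k|] //=; lia. Qed.

Lemma is_predP (u v w : 'I_n) : is_pred u w v <-> witness D u v w.
Proof.
split=> [/and3P[lt_F lt_B /allP eq_F]|[t Dt [[k Dk lt_kt] eq_le]]].
  have /eqP := distE u v; case Dt: (D u v) => [t|] /eqP Ft; last lia.
  exists t => //; split.
    by move: lt_F lt_B; rewrite Ft distE; case: (D u w) => [k|]; [exists k => //; lia|lia].
  move=> x; have := eq_F x; rewrite mem_iota /= add0n ltn_ord Ft => /(_ isT)/eqP.
  by rewrite !le_distE // -?Ft.
have lt_B := input_atD_lt Dt.
have Ft : F u v = t.+1 by rewrite distE Dt.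
have Fk : F u w = k.+1 by rewrite distE Dk.
rewrite /is_pred Ft Fk ltnS lt_kt lt_B /=; apply/allP => x.
rewrite mem_iota add0n /= => lt_x.
by rewrite -[x]/(val (Ordinal lt_x)) !le_distE // eq_le.
Qed.

Lemma realizable_entries :
  realizable D -> all (fun u => all (entry_ok n input_at u) (iota 0 n)) (iota 0 n).
Proof.
case=> G eq_D; apply/allP => u; rewrite mem_iota add0n => /= lt_u.
apply/allP => v; rewrite mem_iota add0n => /= lt_v.
pose ou := Ordinal lt_u; pose ov := Ordinal lt_v.
rewrite /entry_ok; have [//|neq] /= := eqVneq u v; apply/orP.
case Dt: (D ou ov) => [t|]; last by left; rewrite -[F u v]/(F ou ov) distE Dt.
right; have [|w wit] := @NS_Fo_witness _ G ou ov t _ (etrans (congr1 (fun M : 'M_n => M ou ov) eq_D) Dt).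
  by rewrite -val_eqE.
rewrite eq_D in wit; apply: (@pred_of_gt0 _ _ _ _ w) => //.
exact/(is_predP ou ov).
Qed.

Variable L : seq (nat * nat * nat).
Hypothesis uniq_L : uniq L.
Hypothesis mem_L : forall k, k \in L <-> exists u v,
  [/\ u < n, v < n, 0 < pred_of u v & k = key u v].

(** Every listed triple stems from a witness, whose columns agree at its time, so the labels are
    sound; [entry_ok] supplies a predecessor for each finite entry off the diagonal. *)
Lemma entries_realize :
  all (fun u => all (entry_ok n input_at u) (iota 0 n)) (iota 0 n) ->
  exists G : tgraph n,
    [/\ lists_tgraph L G, NS_Fo G = D & num_labels G <= size L].
Proof.
move=> /allP ok.
have [a b t|G [lists_L le_size labG]] := @tgraph_of_list n L uniq_L.
  case/mem_L => u [v [lt_u lt_v p_gt0 [-> -> ->]]].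
  have [lt_w /and3P[lt_F _ _]] := pred_ofP p_gt0.
  have neq : (pred_of u v).-1 <> v by move=> E; move: lt_F; rewrite E ltnn.
  by have := dist_gt0 n input_at u (pred_of u v).-1; split; lia.
exists G; split=> //; apply: NS_Fo_eq => //.
  have sym (v w : 'I_n) t x : (val v, val w, t) \in L ->
      le_time (D x v) t = le_time (D x w) t.
    case/mem_L => u [v' [lt_u lt_v' p_gt0 [e1 e2 e3]]].
    have [lt_w' pr] := pred_ofP p_gt0.
    pose ou := Ordinal lt_u; pose ov := Ordinal lt_v'; pose ow := Ordinal lt_w'.
    have [t' Dt' [_ eq_le]] := (is_predP ou ov ow).1 pr.
    have et : t = t' by rewrite e3 -[F u v']/(F ou ov) distE Dt'.
    have := eq_le x; rewrite -et.
    (* The ends in a triple are sorted, so either may be the target; the agreement of columns is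
       symmetric. *)
    have [[-> ->]|[-> ->]] : (v = ov /\ w = ow) \/ (v = ow /\ w = ov).
    - rewrite /= in e1 e2.
      have [[h1 h2]|[h1 h2]] : (v = v' :> nat /\ w = (pred_of u v').-1 :> nat) \/
          (v = (pred_of u v').-1 :> nat /\ w = v' :> nat) by lia.
        by left; split; apply: val_inj.
      by right; split; apply: val_inj.
    - by move->.
    by move->.
  move=> v w t x; rewrite labG => /orP[] /sym; first by apply.
  by move=> ->.
move=> u v t neq Dt.
have := ok u; rewrite mem_iota add0n ltn_ord => /(_ isT)/allP/(_ v).
rewrite mem_iota add0n ltn_ord => /(_ isT); rewrite /entry_ok val_eqE (negPf neq) /=.
rewrite (distE u v) Dt leqNgt (input_atD_lt Dt) /= => p_gt0.
have [lt_w pr] := pred_ofP p_gt0; pose w := Ordinal lt_w.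
have [t' Dt' [lt_k _]] := (is_predP u v w).1 pr.
have et : t' = t by move: Dt'; rewrite Dt => -[].
exists w; rewrite -et; split=> //; rewrite labG et.
have : key u v \in L.
  by apply/mem_L; exists (val u), (val v); split=> //; apply: ltn_ord.
rewrite /key (distE u v) Dt -[(pred_of u v).-1]/(val w) /=.
by rewrite /minn /maxn; case: ifP => _ kL; apply/orP; [right|left]; exact: kL.
Qed.

End Instance.

(** * The two programs and their time, space and word bounds *)

Definition block_size (n : nat) : nat := 3 * (n * n) + n + 2.

Definition init_size : prog :=
  Assign 1 (Plus (Plus (Times (Const 3) (Times (Reg 0) (Reg 0))) (Reg 0)) (Const 2)).

Definition decider : prog :=
  Seq (Seq init_size (prog_of main)) (Assign 0 (Reg 13)).

Definition realizer : prog :=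
  Seq (Seq init_size (prog_of main))
    (Seq (Assign 0 (Reg 9)) (Assign 1 (Times (Const 5) (Reg 1)))).

Definition time_bound (n : nat) : nat := cmd_time n main + 20.
Definition space_bound (n : nat) : nat := 6 * block_size n.

(** Loops nest three deep, which gives a multiple of [n.+1 ^ 3], at most [8 * n ^ 3]; the logarithm
    is at least 1 from [n = 2] on. *)
Lemma time_bound_bigO : bigO time_bound (fun n => n ^ 3 * trunc_log 2 n).
Proof.
have [K le_K] := cmd_time_poly main.
exists (8 * (K + 20)), 2 => n n_ge2; rewrite /time_bound.
have log_gt0 : 0 < trunc_log 2 n by rewrite trunc_log_gt0.
apply: (@leq_trans (8 * (K + 20) * n ^ 3)); last first.
  by rewrite leq_mul2l leq_pmulr ?orbT.
have : n.+1 ^ 3 <= (2 * n) ^ 3 by rewrite leq_exp2r //; lia.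
have : 0 < n.+1 ^ 3 by rewrite expn_gt0.
have := le_K n; rewrite (_ : for_depth main = 3) // expnMn.
move: (cmd_time n main) (n.+1 ^ 3) (n ^ 3) => T a b; nia.
Qed.

Lemma space_bound_bigO : bigO space_bound (fun n => n ^ 2).
Proof. by exists 36, 1 => n n_ge1; rewrite /space_bound /block_size -mulnn; nia. Qed.

(** A crude bound on the cost of every expression of [main], checked by computation; its size
    affects only the exponent of the word bound. *)
Definition expr_bound : nat := 200.

Lemma small_main : small_cmd 5 expr_bound main.
Proof.
rewrite /main /calc_inf /max_entry /find_preds /rank_col /rank_acc /try_pred
  /prefix_max /clear /bucket /sweep_max /mark /all_preds /emit /emit_one
  /scan_dup /put /emax /emin /enot !entE !idxE.
by vm_compute.
Qed.

Definition max_finite n (D : 'M[option nat]_n) : nat :=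
  \max_(u < n) \max_(v < n) odflt 0 (D u v).

(** Large enough for the block size, for the code of infinity, which is at most the largest finite
    entry plus 2, and for the constants of [main], at most 5. *)
Definition value_bound n (D : 'M[option nat]_n) : nat :=
  block_size n + max_finite D + 5.

(** With [X = n + max_finite D + 2], at least 2, one has [V <= 8 * X^2 <= X^5]; the final 1 makes
    the inequality strict. *)
Definition word_exp : nat := 5 * expr_bound + 1.

Section Execution.
Variables (n : nat) (D : 'M[option nat]_n).
Local Notation S := (block_size n).
Local Notation V := (value_bound D).
Local Notation w := (word_bound word_exp D).

Lemma encode_le (u v : 'I_n) : encode (D u v) <= (max_finite D).+1.
Proof.
have : odflt 0 (D u v) <= max_finite D.
  by apply: (bigmax_sup u) => //; apply: (bigmax_sup v).
by case: (D u v).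
Qed.

Lemma value_bound_lt : V ^ expr_bound < w.
Proof.
rewrite /word_bound -/(max_finite D) /word_exp addn1.
set X := n + _ + 2.
have X_ge2 : 1 < X by rewrite /X; lia.
have le_V : V <= X ^ 5.
  have X2 : 4 <= X * X by nia.
  have : V <= 8 * (X * X) by rewrite /value_bound /block_size /X; nia.
  have : 8 <= X * X * X by nia.
  by rewrite !expnS expn0 muln1; nia.
apply: leq_ltn_trans (_ : X ^ (5 * expr_bound) < _).
  by rewrite expnM leq_exp2r.
by rewrite ltn_exp2l.
Qed.

(** Makes room for the address [5 * S] of the output block, which the realizer computes after
    [main]. *)
Lemma value_bound2_lt : V * V < w.
Proof.
apply: leq_ltn_trans value_bound_lt.
by rewrite mulnn leq_pexp2l // /value_bound; lia.
Qed.

Lemma value_bound_lt1 : V < w.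
Proof.
apply: leq_ltn_trans value_bound2_lt.
by rewrite leq_pmulr // /value_bound; lia.
Qed.

Lemma input_bounded : bounded V (input D).
Proof.
split=> [r|a] /=.
  by rewrite /upd; case: eqP => // _; rewrite /value_bound /block_size; lia.
set s := [seq _ | _ <- _, _ <- _].
case: (ltnP a (size s)) => [lt_a|le_a]; last by rewrite nth_default.
have /allpairsP[[u v] [_ _ ->]] := mem_nth 0 lt_a.
by have := encode_le u v; rewrite /value_bound /=; lia.
Qed.

Lemma infty_le : infty n (input_at D) <= V.
Proof.
rewrite /infty /value_bound.
suff : \max_(0 <= x < n) \max_(0 <= v < n) input_at D x v <= (max_finite D).+1 by lia.
apply/bigmax_natP => x lt_x; apply/bigmax_natP => v lt_v.
by rewrite (input_atE D (Ordinal lt_x) (Ordinal lt_v)) encode_le.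
Qed.

Lemma exec_main : exists st t,
  [/\ exec (space_bound n) w (Seq init_size (prog_of main)) (input D) st t,
      t <= cmd_time n main + 10,
      bounded V st /\ regs st 1 = S,
      regs st 13 = all (fun u => all (entry_ok n (input_at D) u) (iota 0 n)) (iota 0 n) &
      exists L : seq (nat * nat * nat), [/\ uniq L, size L <= n * n,
        forall k, k \in L <-> exists u v,
          [/\ u < n, v < n, 0 < pred_of n (input_at D) u v &
              k = key n (input_at D) u v],
        regs st 9 = size L &
        [seq (cells st (5 * S + 3 * i), cells st (5 * S + 3 * i + 1),
              cells st (5 * S + 3 * i + 2)) | i <- iota 0 (size L)] = L]].
Proof.
have [in_regs in_cells] := input_bounded.
have S_le : S + 5 <= V by rewrite /value_bound; lia.
have V_lt : V < w := value_bound_lt1.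
pose st0 := State (upd (regs (input D)) 1 S) (cells (input D)).
have ex0 : exec (space_bound n) w init_size (input D) st0 10.
  apply: (@ExecAssign _ _ 1 (Plus (Plus (Times (Const 3) (Times (Reg 0) (Reg 0))) (Reg 0)) (Const 2))).
  move: (word_bound _ _) (value_bound D) S_le V_lt => W V'; rewrite /block_size => S_le V_lt.
  by rewrite /= /upd /=; have := leq_pmull n (_ : 0 < 3); lia.
pose ast0 := AState (regs st0) (fun k i => cells (input D) (k * S + i)).
have ref0 : refines 6 n S V st0 ast0.
  split=> //; split=> //= r; rewrite /upd; case: eqP => // _; last exact: in_regs.
  by lia.
have size_in : size [seq encode (D u v) | u <- enum 'I_n, v <- enum 'I_n] = n * n.
  by rewrite size_allpairs size_enum_ord.
have [|||||safe_main [e13 uniq_L le_L mem_L]] :=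
  @mainP n S V (input_at D) _ _ infty_le ast0 => //.
- by lia.
(* Block 1 starts at [S], beyond the [n^2] cells of the matrix, so it initially holds 0. *)
- by move=> i lt_i /=; rewrite nth_default // size_in /block_size; lia.
have [||||||st [t [ex_t le_t [eq_regs _ eqS eq_mem bst]]]] :=
  @exec_prog_of 6 n S V w 5 expr_bound _ _ _ _ value_bound_lt main st0 ast0
    small_main _ _ ref0 safe_main => //; try (rewrite /value_bound /block_size; lia).
exists st, (10 + t); split=> //.
- exact: ExecSeq ex0 ex_t.
- by lia.
- by rewrite eq_regs.
- by rewrite eq_regs.
exists (emitted (run n main ast0)).
have size_L : size (emitted (run n main ast0)) = reg (run n main ast0) 9.
  by rewrite size_map size_iota.
split=> //; rewrite ?size_L //.
apply/eq_in_map => i; rewrite mem_iota add0n => /andP[_ lt_i].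
by rewrite /triple_at -![5 * S + 3 * i + _]addnA !eq_mem //; rewrite /block_size; lia.
Qed.

End Execution.

Theorem theorem3p9 :
  exists time space : nat -> nat,
    [/\ bigO time (fun n => n ^ 3 * trunc_log 2 n),
        bigO space (fun n => n ^ 2),
        exists p : prog, decides_NS_Fo_TGR time space p &
        exists q : prog, computes_NS_Fo_realization time space q].
Proof.
exists time_bound, space_bound; split.
- exact: time_bound_bigO.
- exact: space_bound_bigO.
- exists decider, word_exp => n D Ddist.
  have [st [t [ex_t le_t [[le_regs le_cells] r1] r13 [L [uniq_L _ mem_L _ _]]]]] :=
    exec_main D.
  do 2 eexists; split.
  + apply: ExecSeq ex_t _; apply: (@ExecAssign _ _ 0 (Reg 13)) => /=.
    by rewrite andbT; apply: leq_ltn_trans (le_regs 13) (value_bound_lt1 D).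
  + by rewrite /time_bound; move: (cmd_time n main) le_t => T /=; lia.
  rewrite /= /upd /= r13; congr nat_of_bool; apply/idP/asboolP.
    (* The decider also emits the list of triples; here it only serves to exhibit a realization. *)
    by case/(entries_realize Ddist uniq_L mem_L) => G [_ eq_D _]; exists G.
  exact: realizable_entries.
exists realizer, word_exp => n D Ddist real_D.
have [st [t [ex_t le_t [[le_regs le_cells] r1] r13 [L [uniq_L le_L mem_L r9 eq_L]]]]] :=
  exec_main D.
have V2_lt := value_bound2_lt D.
do 2 eexists; split.
- apply: ExecSeq ex_t _; apply: ExecSeq.
    apply: (@ExecAssign _ _ 0 (Reg 9)) => /=.
    by rewrite andbT; apply: leq_ltn_trans (le_regs 9) (value_bound_lt1 D).
  apply: (@ExecAssign _ _ 1 (Times (Const 5) (Reg 1))).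
  move: (word_bound _ _) V2_lt => W; rewrite /value_bound /= /upd /= r1.
  move: (block_size n) (max_finite D) => S M V2_lt; nia.
- by rewrite /time_bound; move: (cmd_time n main) le_t => T /=; lia.
have [G [lists_L eq_D le_num]] :=
  entries_realize Ddist uniq_L mem_L (realizable_entries real_D).
exists G; split=> //; last by rewrite -mulnn; lia.
by rewrite /output /= /upd /= r1 r9 eq_L.
Qed.
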